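(* Consider the Bass model on the homogeneous complete network with $M$ nodes. Let $\{[S^n](t)\}_{n=1}^M$ and $\{\Psi_n(t)\}_{n=1}^M$ be the solutions of the boundary-value problem, $n=1,\dots,M$, $$\frac{d[S^n]}{dt}=-\Big(np(s_p(t))+n\frac{M-n}{M-1}q(s_q(t))\Big)[S^n]+n\frac{M-n}{M-1}q(s_q(t))[S^{n+1}],\qquad [S^n](0)=1,$$ $$\frac{d\Psi_n}{dt}=\Big(\Psi_n-\mathbf{1}_{n=1}\gamma e^{-\theta t}\Big)\Big(np(s_p(t))+n\frac{M-n}{M-1}q(s_q(t))\Big)-\big(\mathbf{1}_{n>1}\Psi_{n-1}-\mathbf{1}_{n=2}\gamma e^{-\theta t}\big)(n-1)\frac{M-n+1}{M-1}q(s_q(t)),\qquad \Psi_n(T)=0.$$ Then the optimal promotion $\mathbf{s}^{\rm opt}:=(s_p^{\rm opt},s_q^{\rm opt})$, i.e. the maximizer of $\Pi[\mathbf{s}(t)]$ over $\mathcal{S}^2$, satisfies the condition $$\frac{\partial H}{\partial s_p}\bigg|_{\mathbf{s}^{\rm opt}}=\frac{\partial H}{\partial s_q}\bigg|_{\mathbf{s}^{\rm opt}}=0,\qquad H:=\Big(-\gamma\frac{d[S]}{dt}-\big(s_p(t)+s_q(t)\big)\Big)e^{-\theta t}+\sum_{n=1}^{M}\Psi_n\frac{d[S^n]}{dt},$$ where $[S]:=[S^1]$ and in $H$ the derivatives $\frac{d[S^n]}{dt}$ stand for the right-hand sides of the first equation.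
   Context: Bass model on the homogeneous complete network with $M$ nodes: the state of node $j\in\{1,\dots,M\}$ is a random variable $X_j(t)\in\{0,1\}$ ($1$ = adopter), $X_j(0)=0$. Under a promotion $\mathbf{s}(t)=(s_p(t),s_q(t))$ (spending rates per consumer), a nonadopter $j$ adopts at rate $\lambda_j(t)=p(s_p(t))+\frac{q(s_q(t))}{M-1}\sum_{k\ne j}X_k(t)$, where $p$ and $q$ are the external and internal influence rates, and adopters remain adopters; i.e. as $\Delta t\to0$, $\mathbb{P}(X_j(t+\Delta t)=1\mid X_1(t),\dots,X_M(t))$ equals $1$ if $X_j(t)=1$ and $\lambda_j(t)\Delta t$ if $X_j(t)=0$. $T$ is the planning horizon, $\mathcal{S}$ is the set of piecewise-continuous functions from $[0,T]$ to the nonnegative reals, $\theta$ is the discount rate, $\gamma$ is the income generated by the sale of one unit of the product. The expected adoption level is $f(t)=\frac1M\sum_{j=1}^M\mathbf{E}[X_j(t)]$ and the profit is $\Pi[\mathbf{s}(t)]=\int_0^T e^{-\theta t}\big(\gamma\frac{df}{dt}-(s_p(t)+s_q(t))\big)dt$. By symmetry, the probability that all nodes of a set $\Omega$ are nonadopters at time $t$ depends only on $n=|\Omega|$ and is denoted $[S^n](t)$, $n=1,\dots,M$. For $n=M$ the term with $[S^{M+1}]$ has coefficient zero. $\mathbf{1}$ denotes an indicator.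
   Formalization: Each condition ∂H/∂s_p=0, ∂H/∂s_q=0 is claimed only at times where that optimal spending rate is positive and continuous; it fails otherwise (p, q constant: s=0, ∂H/∂s_p=-e^{-θt}). p, q are taken nonnegative, continuous, and differentiable at positive spending. *)

(* Defs.v *)
(* MathComp / MathComp-Analysis. *)
From HB Require Import structures.
From mathcomp Require Export all_boot all_order all_algebra.
From mathcomp Require Export all_classical all_reals all_analysis.
Export Order.TTheory GRing.Theory Num.Theory.
Export numFieldNormedType.Exports.

Set Implicit Arguments.
Unset Strict Implicit.
Unset Printing Implicit Defensive.

Local Open Scope classical_set_scope.
Local Open Scope ring_scope.

(* Functions on [0, T] are represented by functions on R whose values outside
   [0, T] are never used; limits at the endpoints are taken inside [0, T]. *)
Definition continuous_in (R : realType) (T : R) (g : R -> R) (t : R) : Prop :=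
  g @ within `[0, T] (nbhs t) --> g t.

(* The value of g at a discontinuity is not constrained. *)
Definition piecewise_continuous (R : realType) (T : R) (g : R -> R) : Prop :=
  [/\ exists E : seq R,
        forall t : R, t \in `[0, T] -> t \notin E -> continuous_in T g t,
      forall t : R, t \in `[0, T[ -> cvg (g u @[u --> t^'+]) &
      forall t : R, t \in `]0, T] -> cvg (g u @[u --> t^'-])].

Record promotion (R : realType) := Promotion {
  spend_p : R -> R;
  spend_q : R -> R
}.

Definition admissible_spending (R : realType) (T : R) (g : R -> R) : Prop :=
  piecewise_continuous T g /\ (forall t : R, t \in `[0, T] -> 0 <= g t).

Definition admissible (R : realType) (T : R) (s : promotion R) : Prop :=
  admissible_spending T (spend_p s) /\ admissible_spending T (spend_q s).

Definition promotion_continuous_in (R : realType) (T : R) (s : promotion R)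
    (t : R) : Prop :=
  continuous_in T (spend_p s) t /\ continuous_in T (spend_q s) t.

(* Differentiability is not required at zero spending, so that responses such
   as c0 + c1 * sqrt x are covered. *)
Definition influence_rate (R : realType) (r : R -> R) : Prop :=
  [/\ forall x : R, 0 <= x -> 0 <= r x,
      {within `[0, +oo[, continuous r} &
      forall x : R, 0 < x -> derivable r x 1].

(* Adoption rate of node j when the network is in state x. *)
Definition adoption_rate (R : realType) (M : nat) (p q : R -> R)
    (s : promotion R) (t : R) (x : 'I_M -> bool) (j : 'I_M) : R :=
  p (spend_p s t)
  + q (spend_q s t) / (M%:R - 1) * \sum_(k < M | k != j) (x k)%:R.

Definition cond_prob (R : realType) (d : measure_display)
    (Omega : measurableType d) (P : probability Omega R) (A B : set Omega) : R :=
  fine (P (A `&` B)) / fine (P B).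

(* X j t w = true iff node j is an adopter at time t.
   - The one-step law is imposed at the times where s is continuous; at a jump
     of s the rate at t is not determined by s t.
   - The fourth clause makes simultaneous adoptions of order o(h): the
     individual one-step laws alone do not determine the joint one.
   - The last clause says that no node adopts at a prescribed instant with
     positive probability; the forward o(h) condition, which need not be
     uniform in t, does not exclude it. *)
Definition bass_process (R : realType) (M : nat) (T : R) (p q : R -> R)
    (d : measure_display) (Omega : measurableType d) (P : probability Omega R)
    (s : promotion R) (X : 'I_M -> R -> {RV P >-> bool}) : Prop :=
  let state t (x : 'I_M -> bool) := [set w | forall k, X k t w = x k] in
  let adopted j t := [set w | X j t w = true] in
  [/\ forall j w, X j 0 w = false,
      forall (j : 'I_M) (t u : R) w, 0 <= t -> t <= u -> u <= T ->
        X j t w = true -> X j u w = true,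
      forall t : R, t \in `[0, T[ -> promotion_continuous_in T s t ->
        forall x : 'I_M -> bool, (0 < P (state t x))%E ->
        forall j, x j = false ->
        cond_prob P (adopted j (t + h)) (state t x) / h @[h --> 0^'+]
          --> adoption_rate p q s t x j,
      forall t : R, t \in `[0, T[ -> promotion_continuous_in T s t ->
        forall x : 'I_M -> bool, (0 < P (state t x))%E ->
        forall j k : 'I_M, j != k -> x j = false -> x k = false ->
        cond_prob P (adopted j (t + h) `&` adopted k (t + h)) (state t x) / h
          @[h --> 0^'+] --> (0 : R) &
      forall j, {within `[0, T], continuous
        (fun t : R => fine (P (adopted j t)) : R)}].

Definition adoption_level (R : realType) (M : nat)
    (d : measure_display) (Omega : measurableType d) (P : probability Omega R)
    (X : 'I_M -> R -> {RV P >-> bool}) (t : R) : R :=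
  M%:R^-1 * \sum_(j < M) fine ('E_P[fun w => (X j t w)%:R : R])%E.

Definition profit (R : realType) (M : nat) (T theta gamma : R)
    (d : measure_display) (Omega : measurableType d) (P : probability Omega R)
    (s : promotion R) (X : 'I_M -> R -> {RV P >-> bool}) : R :=
  (\int[lebesgue_measure]_(t in `[0, T])
     (expR (- (theta * t)) *
      (gamma * ((adoption_level X)^`())%classic t - (spend_p s t + spend_q s t))))%R.

(* X s is the network process under the promotion s. *)
Definition optimal_promotion (R : realType) (M : nat) (T theta gamma : R)
    (d : measure_display) (Omega : measurableType d) (P : probability Omega R)
    (X : promotion R -> 'I_M -> R -> {RV P >-> bool}) (sopt : promotion R)
    : Prop :=
  admissible T sopt /\
  (forall s, admissible T s ->
     profit T theta gamma s (X s) <= profit T theta gamma sopt (X sopt)).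

(* Right-hand side of the equation for [S^n] under the spending rates
   x = s_p, y = s_q; y_n stands for [S^n]. For n = M the term with y_(M+1)
   has coefficient 0. *)
Definition nonadopter_rhs (R : realType) (M : nat) (p q : R -> R)
    (y_ : nat -> R) (n : nat) (x y : R) : R :=
  - (n%:R * p x + n%:R * ((M%:R - n%:R) / (M%:R - 1)) * q y) * y_ n
  + n%:R * ((M%:R - n%:R) / (M%:R - 1)) * q y * y_ n.+1.

(* Right-hand side of the equation for Psi_n at time t. For n = 1 the term
   with Psi_0 has coefficient 0. *)
Definition costate_rhs (R : realType) (M : nat) (theta gamma : R)
    (p q : R -> R) (psi_ : nat -> R) (t : R) (n : nat) (x y : R) : R :=
  (psi_ n - (n == 1%N)%:R * (gamma * expR (- (theta * t))))
    * (n%:R * p x + n%:R * ((M%:R - n%:R) / (M%:R - 1)) * q y)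
  - ((1 < n)%N%:R * psi_ n.-1 - (n == 2%N)%:R * (gamma * expR (- (theta * t))))
    * ((n%:R - 1) * ((M%:R - n%:R + 1) / (M%:R - 1))) * q y.

(* Since s may jump, a solution is a continuous function on [0, T] that
   satisfies the differential equation where s is continuous. *)
Definition nonadopter_solution (R : realType) (M : nat) (T : R)
    (p q : R -> R) (s : promotion R) (y_ : nat -> R -> R) : Prop :=
  forall n, (1 <= n <= M)%N ->
    [/\ {within `[0, T], continuous (y_ n)},
        y_ n 0 = 1 &
        forall t : R, t \in `]0, T[ -> promotion_continuous_in T s t ->
          is_derive t 1 (y_ n)
            (nonadopter_rhs M p q (y_ ^~ t) n (spend_p s t) (spend_q s t))].

Definition costate_solution (R : realType) (M : nat) (T theta gamma : R)
    (p q : R -> R) (s : promotion R) (psi_ : nat -> R -> R) : Prop :=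
  forall n, (1 <= n <= M)%N ->
    [/\ {within `[0, T], continuous (psi_ n)},
        psi_ n T = 0 &
        forall t : R, t \in `]0, T[ -> promotion_continuous_in T s t ->
          is_derive t 1 (psi_ n)
            (costate_rhs M theta gamma p q (psi_ ^~ t) t n
               (spend_p s t) (spend_q s t))].

Definition hamiltonian (R : realType) (M : nat) (theta gamma : R)
    (p q : R -> R) (y_ psi_ : nat -> R -> R) (t x y : R) : R :=
  (- gamma * nonadopter_rhs M p q (y_ ^~ t) 1 x y - (x + y))
    * expR (- (theta * t))
  + \sum_(1 <= n < M.+1) psi_ n t * nonadopter_rhs M p q (y_ ^~ t) n x y.

(* Main.v *)
(* Pontryagin's maximum principle by needle variations. Averaging over all
   n-subsets of nodes, [S^n](t) is the mean of C(#nonadopters, n) / C(M, n), and the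
   infinitesimal transition rates of the network yield the equations for [S^n] as a
   forward equation. Replacing the promotion by a constant (v, w) on a short interval
   [a, b[ changes the profit by exactly the integral over [a, b] of
   H(v, w) - H(s_opt), both evaluated along the perturbed state, because Psi solves the
   adjoint of the linear equation for [S^n]. Optimality therefore forces
   H(v, w) <= H(s_opt) at every time where s_opt is continuous. As H splits into a function
   of s_p plus a function of s_q with coefficients continuous in time, the maximality
   of either part passes to the times where only that component is continuous, and there
   the derivative vanishes at the interior maximum. *)
Require Import Defs.
From mathcomp Require Import measurable_realfun zify ring lra.

Set Implicit Arguments.
Unset Strict Implicit.
Unset Printing Implicit Defensive.

Local Open Scope classical_set_scope.
Local Open Scope ring_scope.

(** * Right derivatives *)

(** The one-step law of [bass_process] looks only forward from [t] and is imposed only where the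
    promotion is continuous, so it yields right derivatives off a finite set. Two-sided derivatives
    are recovered from the continuity of the averages and mean-value inequalities for right
    derivatives, at the times where the right-hand side is continuous. The processes under two
    promotions are not coupled: nothing relates their paths. They are compared only through their
    averages, by uniqueness for the linear system, which also identifies the given [S_] with the
    averages under [sopt]. Profits enter as end values of primitives. Since the variation formula is
    exact, comparing two of them is a monotonicity argument for a function differentiable off a
    finite set, with no expansion in the length of the needle and no remainder to estimate. *)

Definition right_derivative (R : realType) (f : R -> R) (t l : R) : Prop :=
  (f (t + h) - f t) / h @[h --> 0^'+] --> l.

Lemma is_derive_right_derivative (R : realType) (f : R -> R) (t l : R) :
  is_derive t 1 f l -> right_derivative f t l.
Proof.
move=> [df <-].
have df' : h^-1 *: (f (h *: 1 + t) - f t) @[h --> 0^'] --> 'D_1 f t by exact: df.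
rewrite /right_derivative.
have -> : (fun h => (f (t + h) - f t) / h) =
          (fun h => h^-1 *: (f (h *: 1 + t) - f t)).
  by apply/funext => h; rewrite [h *: 1]mulr1 addrC [t + h]addrC mulrC addrC.
apply: cvg_trans df'; apply: cvg_app.
move=> A [e egt0 Ae]; exists e => // x xe xgt0; apply: Ae => //.
exact/lt0r_neq0.
Qed.

Lemma decreasing_of_right_derivative_lt0 (R : realType) (f r : R -> R) (a b : R) :
  a <= b -> {within `[a, b], continuous f} ->
  (forall t, a < t < b -> right_derivative f t (r t)) ->
  (forall t, a < t < b -> r t < 0) -> f b <= f a.
Proof.
rewrite le_eqVlt => /predU1P[->//|ab] cf rf rlt0.
(* No right derivative is assumed at [a], so a minimum there could not be excluded. The comparison
   is made from [c > a], and [c] then tends to [a] by continuity. *)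
have le_in c : a < c < b -> f b <= f c.
  move=> /andP[ac cb].
  have ccf : {within `[c, b], continuous f}.
    apply: continuous_subspaceW cf => x /=; rewrite !in_itv/= => /andP[cx ->].
    by rewrite (le_trans (ltW ac)).
  (* A minimum point before [b] would have a nonnegative right derivative. *)
  have [m + mmin] := EVT_min (ltW cb) ccf.
  rewrite in_itv/= => /andP[cm mb].
  have [->|mneb] := eqVneq b m.
    by apply: mmin; rewrite in_itv/= lexx ltW.
  have mltb : m < b by rewrite lt_neqAle eq_sym mneb.
  have amb : a < m < b by rewrite mltb (lt_le_trans ac).
  have /= H := rf _ amb.
  suff : 0 <= r m by rewrite leNgt rlt0.
  rewrite -(cvg_lim _ H)//; apply: limr_ge; first by apply/cvg_ex; exists (r m).
  near=> h; apply: divr_ge0; last by near: h; exact: nbhs_right_ge.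
  rewrite subr_ge0; apply: mmin; rewrite in_itv/=; apply/andP; split.
    by rewrite (le_trans cm)// lerDl; near: h; exact: nbhs_right_ge.
  by rewrite -lerBrDl; near: h; apply: nbhs_right_le; rewrite subr_gt0.
have [_ fa _] := (continuous_within_itvP f ab).1 cf.
rewrite -(cvg_lim _ fa)//; apply: limr_ge; first by apply/cvg_ex; exists (f a).
near=> c; apply: le_in; apply/andP; split; near: c.
  exact: nbhs_right_gt.
exact: nbhs_right_lt.
Unshelve. all: by end_near. Qed.

Lemma right_derivative_affine (R : realType) (f : R -> R) (t l k : R) :
  right_derivative f t l -> right_derivative (fun u => f u - k * u) t (l - k).
Proof.
move=> fl; rewrite /right_derivative.
apply: (@cvg_trans _ ((f (t + h) - f t) / h - k @[h --> 0^'+])); last first.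
  by apply: cvgB => //; exact: cvg_cst.
apply: near_eq_cvg; near=> h.
have h0 : h != 0 by rewrite gt_eqF//; near: h; exact: nbhs_right_gt.
by field.
Unshelve. all: by end_near. Qed.

Lemma right_derivativeN (R : realType) (f : R -> R) (t l : R) :
  right_derivative f t l -> right_derivative (fun u => - f u) t (- l).
Proof.
move=> /cvgN; rewrite /right_derivative.
by under [X in X @ _ --> _ -> _]funext => h do rewrite /= -mulNr opprD.
Qed.

(** Exceptional points are removed one at a time: the interval is split at such a point and the two
    increments are added. *)
Lemma right_derivative_le (R : realType) (E : seq R) (f r : R -> R) (a b K : R) :
  a <= b -> {within `[a, b], continuous f} ->
  (forall t, a < t < b -> t \notin E -> right_derivative f t (r t)) ->
  (forall t, a < t < b -> t \notin E -> r t <= K) -> f b - f a <= K * (b - a).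
Proof.
elim: E a b => [|e E IH] a b ab cf rf rK; last first.
  have [/andP[ae eb]|aeb] := boolP (a < e < b); last first.
    apply: IH => // t tab tE; [apply: rf|apply: rK] => //; rewrite inE negb_or tE andbT.
      by apply: contraNneq aeb => <-.
    by apply: contraNneq aeb => <-.
  have -> : f b - f a = (f e - f a) + (f b - f e) by lra.
  have -> : K * (b - a) = K * (e - a) + K * (b - e) by lra.
  apply: lerD; apply: IH; rewrite ?(ltW ae) ?(ltW eb)//.
  - apply: continuous_subspaceW cf => x /=; rewrite !in_itv/= => /andP[->/= xe].
    by rewrite (le_trans xe)// ltW.
  - move=> t /andP[a_t te] tE; apply: rf; first by rewrite a_t (lt_trans te).
    by rewrite inE negb_or tE andbT lt_eqF.
  - move=> t /andP[a_t te] tE; apply: rK; first by rewrite a_t (lt_trans te).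
    by rewrite inE negb_or tE andbT lt_eqF.
  - apply: continuous_subspaceW cf => x /=; rewrite !in_itv/= => /andP[ex ->].
    by rewrite (le_trans (ltW ae)).
  - move=> t /andP[et tb] tE; apply: rf; first by rewrite tb (lt_trans ae).
    by rewrite inE negb_or tE andbT gt_eqF.
  - move=> t /andP[et tb] tE; apply: rK; first by rewrite tb (lt_trans ae).
    by rewrite inE negb_or tE andbT gt_eqF.
have -> : (f b - f a <= K * (b - a)) = (f b - K * b <= f a - K * a).
  by apply/idP/idP; lra.
apply/ler_addgt0Pr => e e0.
have [->|ba] := eqVneq b a; first by rewrite lerDl ltW.
have ba0 : 0 < b - a by rewrite subr_gt0 lt_neqAle eq_sym ba.
(* Raising the slope by [e / (b - a)] makes the right derivative strictly negative and costs exactly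
   [e] over the whole interval. *)
pose k := K + e / (b - a).
suff : f b - k * b <= f a - k * a.
  suff : e / (b - a) * (b - a) = e by rewrite /k; lra.
  by rewrite divfK// gt_eqF.
apply: (@decreasing_of_right_derivative_lt0 _ (fun u => f u - k * u) (fun u => r u - k)) => //.
- move=> x; apply: cvgB; first exact: cf.
  apply: continuous_subspaceT => {}x.
  by apply: cvgM; [exact: cvg_cst|exact: cvg_id].
- by move=> t tab; apply: right_derivative_affine; exact: rf.
- move=> t tab; rewrite subr_lt0 (le_lt_trans (rK _ tab _))// /k ltrDl.
  exact: divr_gt0.
Qed.

Lemma right_derivative_dist_le (R : realType) (E : seq R) (f r : R -> R) (a b l e : R) :
  a <= b -> {within `[a, b], continuous f} ->
  (forall t, a < t < b -> t \notin E -> right_derivative f t (r t)) ->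
  (forall t, a < t < b -> t \notin E -> `|r t - l| <= e) ->
  `|f b - f a - l * (b - a)| <= e * (b - a).
Proof.
move=> ab cf rf re.
have H1 : f b - f a <= (l + e) * (b - a).
  apply: (right_derivative_le ab cf rf) => t tab tE.
  by have := re t tab tE; rewrite ler_norml; lra.
have H2 : - f b - - f a <= (- l + e) * (b - a).
  apply: (@right_derivative_le _ E (fun u => - f u) (fun u => - r u)) => //.
  - by move=> x; apply: cvgN; exact: cf.
  - by move=> t tab tE; apply: right_derivativeN; exact: rf.
  move=> t tab tE.
  by have := re t tab tE; rewrite ler_norml; lra.
rewrite ler_norml; apply/andP; split; lra.
Qed.

(** Near [t] the right derivative stays within [e] of [r t], so the mean-value inequality controls
    increments on both sides of [t]. The point [t] may itself belong to [E]. *)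
Lemma is_derive_of_right_derivative (R : realType) (E : seq R) (f r : R -> R) (a b t : R) :
  {within `[a, b], continuous f} ->
  (forall u, a < u < b -> u \notin E -> right_derivative f u (r u)) ->
  a < t < b -> {for t, continuous r} -> is_derive t 1 f (r t).
Proof.
move=> cf rf /andP[a_t tb] rt.
suff H : h^-1 *: (f (h *: 1 + t) - f t) @[h --> 0^'] --> r t.
  apply: DeriveDef; first by apply/cvg_ex; exists (r t).
  exact/cvg_lim.
apply/cvgrPdist_le => e e0.
move/cvgrPdist_le: rt => /(_ _ e0)/nbhs_ballP[d /= d0 rd].
pose c := Num.min d (Num.min (t - a) (b - t)).
have c0 : 0 < c by rewrite !lt_min d0 !subr_gt0 a_t tb.
have sub_le u v : t - c < u -> u <= v -> v < t + c -> u <= t <= v ->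
    `|f v - f u - r t * (v - u)| <= e * (v - u).
  move=> uc uv vc tuv.
  have ca : c <= t - a by rewrite !ge_min lexx /= orbT.
  have cb : c <= b - t by rewrite !ge_min lexx /= !orbT.
  have cd : c <= d by rewrite !ge_min lexx.
  apply: (@right_derivative_dist_le _ E f r) => //.
  - apply: continuous_subspaceW cf => x /=; rewrite !in_itv/= => /andP[xu xv].
    by apply/andP; split; lra.
  - by move=> x /andP[xu xv] xE; apply: rf => //; apply/andP; split; lra.
  - move=> x /andP[xu xv] xE; rewrite distrC; apply: rd.
    by rewrite /ball/= ltr_norml; apply/andP; split; lra.
near=> h.
have h0 : h != 0 by near: h; exact: nbhs_dnbhs_neq.
have hc : `|h| < c by near: h; exact: dnbhs0_lt.
rewrite [h *: 1]mulr1 [h^-1 *: _]mulrC.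
have -> : r t - (f (h + t) - f t) * h^-1 = - (f (h + t) - f t - r t * h) / h.
  by field.
rewrite normrM normfV normrN ler_pdivrMr ?normr_gt0//.
move: hc; rewrite ltr_norml => /andP[h1 h2].
have [hge0|hlt0] := leP 0 h.
  have := @sub_le t (h + t); rewrite addrK (ger0_norm hge0); apply => //; try lra.
have := @sub_le (h + t) t; rewrite (ltr0_norm hlt0).
have -> : f t - f (h + t) - r t * (t - (h + t)) = - (f (h + t) - f t - r t * h) by ring.
have -> : t - (h + t) = - h by ring.
rewrite normrN; apply => //; try lra.
Unshelve. all: by end_near. Qed.

Lemma is_derive_ge (R : realType) (E : seq R) (f r : R -> R) (a b K : R) :
  a <= b -> {within `[a, b], continuous f} ->
  (forall t, a < t < b -> t \notin E -> is_derive t 1 f (r t)) ->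
  (forall t, a < t < b -> t \notin E -> K <= r t) -> K * (b - a) <= f b - f a.
Proof.
move=> ab cf df rK.
suff : - f b - - f a <= - K * (b - a) by lra.
apply: (@right_derivative_le _ E (fun u => - f u) (fun u => - r u)) => //.
- by move=> x; apply: cvgN; exact: cf.
- move=> t tab tE; apply: right_derivativeN; apply: is_derive_right_derivative.
  exact: df.
- by move=> t tab tE; rewrite lerN2 rK.
Qed.

(** * Piecewise continuous functions *)

Lemma cvg_dist0 (R : realType) (T : Type) (F : set_system T) (f : T -> R) (l : R)
    {FF : Filter F} :
  f x @[x --> F] --> l -> `|f x - l| @[x --> F] --> (0 : R).
Proof.
move=> fl; rewrite -[X in _ --> X](@normr0 _ R) -[X in `|X| : R](subrr l).
by apply: cvg_norm; apply: cvgB => //; exact: cvg_cst.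
Qed.

Lemma cvg_sumr (R : realType) (T I : Type) (F : set_system T) (r : seq I) (Q : pred I)
    (f : I -> T -> R) (l : I -> R) {FF : Filter F} :
  (forall i, Q i -> f i x @[x --> F] --> l i) ->
  \sum_(i <- r | Q i) f i x @[x --> F] --> \sum_(i <- r | Q i) l i.
Proof. by apply: cvg_big => //; exact: add_continuous. Qed.

Lemma continuous_in_interior (R : realType) (T : R) (g : R -> R) (t : R) :
  t \in `]0, T[ -> continuous_in T g t <-> {for t, continuous g}.
Proof.
move=> t0T; rewrite /continuous_in within_interior//.
by rewrite interior_itv.
Qed.

(** Two one-sided limits and the value at the point give a bound near each point, and compactness of
    the segment makes it uniform. At the ends of [[0, T]] the outer side does not meet the segment,
    so any constant serves there. *)
Lemma piecewise_continuous_bounded (R : realType) (T : R) (g : R -> R) :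
  piecewise_continuous T g ->
  exists C : R, forall t, t \in `[0, T] -> `|g t| <= C.
Proof.
move=> [_ gr gl].
have near_bounded (F : set_system R) : ProperFilter F -> cvg (g u @[u --> F]) ->
    exists C : R, \forall u \near F, `|g u| <= C.
  move=> FF /cvg_ex[l /cvgrPdist_le /(_ 1 ltr01) gl1].
  exists (`|l| + 1); apply: filterS gl1 => u lu.
  by rewrite -lerBlDl (le_trans (lerB_dist _ _))// distrC.
have loc x : x \in `[0, T] -> exists C : R,
    \forall u \near x, u \in `[0, T] -> `|g u| <= C.
  rewrite in_itv/= => /andP[x0 xT].
  have [Cr HCr] : exists C : R, \forall u \near x^'+, u \in `[0, T] -> `|g u| <= C.
    have [Tx|xltT] := leP T x.
      exists 0; near=> u; rewrite in_itv/= => /andP[_ uT].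
      have : x < u by near: u; exact: nbhs_right_gt.
      by lra.
    have [|C HC] := near_bounded _ _ (gr x _); first by rewrite in_itv/= x0.
    by exists C; apply: filterS HC.
  have [Cl HCl] : exists C : R, \forall u \near x^'-, u \in `[0, T] -> `|g u| <= C.
    have [x0'|x0'] := leP x 0.
      exists 0; near=> u; rewrite in_itv/= => /andP[u0 _].
      have : u < x by near: u; exact: nbhs_left_lt.
      by lra.
    have [|C HC] := near_bounded _ _ (gl x _); first by rewrite in_itv/= x0'.
    by exists C; apply: filterS HC.
  exists (Num.max `|g x| (Num.max Cr Cl)).
  rewrite /at_right /at_left /within /= in HCr HCl.
  near=> u => u0T; rewrite !le_max.
  have [ux|xu|->] := ltgtP u x; last by rewrite lexx.
  - apply/orP; right; apply/orP; right; move: ux u0T; near: u; exact: HCl.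
  - apply/orP; right; apply/orP; left; move: xu u0T; near: u; exact: HCr.
have /compact_near_coveringP cov := @segment_compact R 0 T.
have [] := cov R (pinfty_nbhs R) (fun C t => t \in `[0, T] -> `|g t| <= C) _.
  move=> x x0T; have [C HC] := loc x x0T.
  exists ([set u | u \in `[0, T] -> `|g u| <= C], [set D | C <= D]).
    by split => //=; apply: nbhs_pinfty_ge; exact: num_real.
  by move=> [u D] /= [uC CD] /uC /le_trans; apply.
move=> A [Areal HA]; exists (A + 1) => t t0T.
by apply: HA => //; rewrite ltrDl.
Unshelve. all: by end_near. Qed.

Definition needle (R : realType) (g : R -> R) (a b v u : R) : R :=
  if a <= u < b then v else g u.

(** Every one-sided neighbourhood is eventually inside [[a, b[] or outside it; there the needle is
    constant or equal to [g]. Only [a] and [b] join the exceptional set. *)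
Lemma piecewise_continuous_needle (R : realType) (T : R) (g : R -> R) (a b v : R) :
  piecewise_continuous T g -> piecewise_continuous T (needle g a b v).
Proof.
have [ab|ba] := ltP a b; last first.
  have -> // : needle g a b v = g.
  apply/funext => u; rewrite /needle; case: ifP => // /andP[au ub].
  by have := le_lt_trans au ub; rewrite ltNge ba.
have in_near (F : set_system R) : Filter F ->
    (\forall u \near F, a <= u < b) -> cvg (needle g a b v u @[u --> F]).
  move=> FF Fab; apply/cvg_ex; exists v; apply: cvg_near_cst.
  by apply: filterS Fab => u; rewrite /needle => ->.
have out_near (F : set_system R) (l : set_system R) : Filter F ->
    (\forall u \near F, ~~ (a <= u < b)) ->
    g u @[u --> F] `=>` l -> needle g a b v u @[u --> F] `=>` l.
  move=> FF Fab; apply: cvg_trans; apply: near_eq_cvg.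
  by apply: filterS Fab => u; rewrite /needle => /negbTE ->.
move=> [[E gE] gr gl]; split.
- exists [:: a, b & E] => t t0T; rewrite !inE !negb_or => /and3P[ta tb tE].
  have gt := gE t t0T tE; rewrite /continuous_in.
  have [tab|tab] := boolP (a <= t < b).
    have near_ab : \forall u \near within `[0, T] (nbhs t), a <= u < b.
      move: tab => /andP[at_ tb']; apply: cvg_within.
      near=> u; rewrite (ltW (_ : a < u)) /=; near: u.
        exact: lt_nbhsl.
      by apply: lt_nbhsr; rewrite lt_neqAle eq_sym ta.
    rewrite {2}/needle tab; apply: cvg_near_cst.
    by apply: filterS near_ab => u; rewrite /needle => ->.
  rewrite {2}/needle (negbTE tab); apply: out_near gt.
  apply: cvg_within; move: tab; rewrite negb_and -ltNge -leNgt => /orP[ta'|bt].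
    near=> u; rewrite negb_and -ltNge; apply/orP; left; near: u.
    exact: lt_nbhsl.
  near=> u; rewrite negb_and -!leNgt; apply/orP; right; apply: ltW; near: u.
  by apply: lt_nbhsr; rewrite lt_neqAle eq_sym tb.
- move=> t t0T; have := gr t t0T => /cvg_ex[l gl'].
  have [ta|at_] := ltP t a.
    apply/cvg_ex; exists l; apply: out_near gl'; near=> u.
    by rewrite negb_and -ltNge; apply/orP; left; near: u; exact: nbhs_right_lt.
  have [tb|bt] := ltP t b.
    apply: in_near; near=> u; apply/andP; split.
      by apply: (le_trans at_); near: u; exact: nbhs_right_ge.
    by near: u; exact: nbhs_right_lt.
  apply/cvg_ex; exists l; apply: out_near gl'; near=> u.
  rewrite negb_and -!leNgt; apply/orP; right; apply: (le_trans bt).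
  by near: u; exact: nbhs_right_ge.
- move=> t t0T; have := gl t t0T => /cvg_ex[l gl'].
  have [ta|at_] := leP t a.
    apply/cvg_ex; exists l; apply: out_near gl'; near=> u.
    rewrite negb_and -ltNge; apply/orP; left; apply: lt_le_trans ta.
    by near: u; exact: nbhs_left_lt.
  have [tb|bt] := leP t b.
    apply: in_near; near=> u; apply/andP; split.
      by near: u; exact: nbhs_left_ge.
    by apply: lt_le_trans tb; near: u; exact: nbhs_left_lt.
  apply/cvg_ex; exists l; apply: out_near gl'; near=> u.
  rewrite negb_and -!leNgt; apply/orP; right.
  by near: u; exact: nbhs_left_ge.
Unshelve. all: by end_near. Qed.

Lemma near_notin (R : realType) (E : seq R) (t : R) : t \notin E ->
  \forall u \near t, u \notin E.
Proof.
elim: E => [|e E IH]; first by move=> _; near=> u.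
rewrite inE negb_or => /andP[te /IH uE].
near=> u; rewrite inE negb_or; apply/andP; split; near: u => //.
exact: (open_neq te).
Unshelve. all: by end_near. Qed.

Lemma continuous_bounded_integrable (R : realType) (T C : R) (E : seq R) (h : R -> R) :
  (forall t : R, t \in `]0, T[ -> t \notin E -> {for t, continuous h}) ->
  (forall t : R, t \in `]0, T[ -> t \notin E -> `|h t| <= C) ->
  (@lebesgue_measure R).-integrable `[0, T] (EFin \o h).
Proof.
move=> ch hC.
pose A := `]0, T[ `&` [set t | t \notin E].
pose B := `[0, T] `&` [set` [:: 0, T & E]].
have itvE : `[0, T]%classic = A `|` B.
  apply/seteqP; split => [t|t [[+ _]|[]]//]; last exact: subset_itv_oo_cc.
  rewrite /A/B/= => t0T; have [tE|tE] := boolP (t \in [:: 0, T & E]); first by right.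
  left; move: tE; rewrite !inE !negb_or => /and3P[t0 tT tE]; split => //.
  by move: t0T; rewrite !in_itv/= !le_eqVlt (negbTE tT) eq_sym (negbTE t0).
have oA : open A.
  apply: openI; first exact: interval_open.
  by rewrite openE => t /= tE; exact: near_notin.
have finB : finite_set B by apply: finite_setIr; exact: finite_seq.
have mA : measurable A by exact: open_measurable.
have mB : measurable B by apply: countable_measurable => //; exact: finite_set_countable.
have mh : measurable_fun `[0, T] h.
  rewrite itvE; apply/measurable_funU => //; split.
    apply: open_continuous_measurable_fun => // t; rewrite inE => -[t0T tE].
    exact: ch.
  move=> _ Y mY; apply: countable_measurable => //.
  by apply: finite_set_countable; exact: finite_setIl.
apply: measurable_bounded_integrable => //.
  exact: compact_finite_measure (@segment_compact _ _ _).
(* The bound [C] holds only off [E] inside the interval; the sum covers the finitely many remaining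
   points, where [h] is arbitrary. *)
exists (`|C| + \sum_(e <- [:: 0, T & E]) `|h e|); split; first exact: num_real.
move=> x Cx t; rewrite itvE => tAB; apply: le_trans (ltW Cx).
have sum0 r : 0 <= \sum_(e <- r) `|h e| by apply: sumr_ge0.
case: tAB => [[t0T tE]|[_ /= tE]].
  by apply: le_trans (hC t t0T tE) _; rewrite (le_trans (ler_norm C))// lerDl.
by rewrite (big_rem t)//= addrCA lerDl addr_ge0.
Qed.

(** * Finite-valued random elements *)

(** The expectation of [phi] at [Z], kept as a finite sum so that linearity and limits in time
    reduce to finitely many terms. *)
Definition fin_mean (R : realType) (d : measure_display) (Omega : measurableType d)
    (P : probability Omega R) (F : finType) (Z : Omega -> F) (phi : F -> R) : R :=
  \sum_z phi z * fine (P [set w | Z w = z]).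

Section FinMean.
Context (R : realType) (d : measure_display) (Omega : measurableType d)
  (P : probability Omega R).
Implicit Types F : finType.

Lemma fine_prob_ge0 (A : set Omega) : 0 <= fine (P A).
Proof. exact/fine_ge0/measure_ge0. Qed.

Lemma fin_meanD F (Z : Omega -> F) (phi psi : F -> R) :
  fin_mean P Z (fun z => phi z + psi z) = fin_mean P Z phi + fin_mean P Z psi.
Proof. by rewrite /fin_mean -big_split; apply: eq_bigr => z _; rewrite mulrDl. Qed.

Lemma fin_meanZ F (Z : Omega -> F) (c : R) (phi : F -> R) :
  fin_mean P Z (fun z => c * phi z) = c * fin_mean P Z phi.
Proof. by rewrite /fin_mean big_distrr /=; apply: eq_bigr => z _; rewrite mulrA. Qed.

Lemma fin_meanB F (Z : Omega -> F) (phi psi : F -> R) :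
  fin_mean P Z (fun z => phi z - psi z) = fin_mean P Z phi - fin_mean P Z psi.
Proof. by rewrite /fin_mean -sumrB; apply: eq_bigr => z _; rewrite mulrBl. Qed.

Lemma fin_mean_sum F (I : finType) (Q : pred I) (Z : Omega -> F) (phi : I -> F -> R) :
  fin_mean P Z (fun z => \sum_(i | Q i) phi i z) = \sum_(i | Q i) fin_mean P Z (phi i).
Proof.
rewrite /fin_mean exchange_big; apply: eq_bigr => z _ /=.
by rewrite big_distrl.
Qed.

(** A value that [Z] never takes labels an empty event of probability zero, so the comparison is
    needed only along outcomes. Path properties, such as adopters remaining adopters, enter through
    this. *)
Lemma fin_mean_le F (Z : Omega -> F) (phi psi : F -> R) :
  (forall w, phi (Z w) <= psi (Z w)) -> fin_mean P Z phi <= fin_mean P Z psi.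
Proof.
move=> le; apply: ler_sum => z _.
have [->|/set0P[w <-]] := eqVneq [set w | Z w = z] set0.
  by rewrite measure0 !mulr0.
by apply: ler_wpM2r; [exact: fine_prob_ge0|exact: le].
Qed.

Lemma fin_mean_norm F (Z : Omega -> F) (phi psi : F -> R) :
  (forall w, `|phi (Z w)| <= psi (Z w)) -> `|fin_mean P Z phi| <= fin_mean P Z psi.
Proof.
move=> le; rewrite ler_norml; apply/andP; split.
  rewrite -mulN1r -fin_meanZ; apply: fin_mean_le => w.
  by rewrite mulN1r; move: (le w); rewrite ler_norml => /andP[].
by apply: fin_mean_le => w; apply: le_trans (le w); exact: ler_norm.
Qed.

Lemma fin_mean_indic F (Z : Omega -> F) (Q : pred F) :
  (forall z, measurable [set w | Z w = z]) ->
  fin_mean P Z (fun z => (Q z)%:R) = fine (P [set w | Q (Z w)]).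
Proof.
move=> mZ.
have -> : [set w | Q (Z w)] = \bigcup_(z in [set` enum Q]) [set w | Z w = z].
  apply/seteqP; split => [w /= Qw|w /= [z /=]].
    by exists (Z w) => //=; rewrite mem_enum.
  by rewrite mem_enum => Qz /= ->.
rewrite measure_fin_bigcup//; last by move=> i j _ _ [w [<- <-]].
rewrite -fsbig_seq ?enum_uniq// big_enum /=.
rewrite -sum_fine => [|z _]; last exact: fin_num_measure.
rewrite /fin_mean [RHS]big_mkcond /=; apply: eq_bigr => z _.
by rewrite unfold_in; case: (Q z); rewrite (mul1r, mul0r).
Qed.

Lemma fin_mean_map F F' (Z : Omega -> F) (g : F -> F') (phi : F' -> R) :
  (forall z, measurable [set w | Z w = z]) ->
  fin_mean P (fun w => g (Z w)) phi = fin_mean P Z (fun z => phi (g z)).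
Proof.
move=> mZ; rewrite {1}/fin_mean.
under eq_bigr => y _.
  have -> : [set w | g (Z w) = y] = [set w | g (Z w) == y].
    by apply/seteqP; split => w /= /eqP.
  rewrite -(fin_mean_indic (fun z => g z == y) mZ) /fin_mean big_distrr /=.
  over.
rewrite exchange_big /=; apply: eq_bigr => z _.
rewrite (bigD1 (g z))//= eqxx mul1r big1 ?addr0// => y.
by rewrite eq_sym => /negbTE ->; rewrite mul0r mulr0.
Qed.

End FinMean.

(** * The random state of the network *)

Section Network.
Context (R : realType) (M : nat) (T : R) (d : measure_display)
  (Omega : measurableType d) (P : probability Omega R)
  (X : 'I_M -> R -> {RV P >-> bool}).
Local Notation F := {ffun 'I_M -> bool}.
Implicit Types (phi : F -> R) (t u h : R).

Definition network_state t (w : Omega) : F := [ffun k => X k t w].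

Lemma measurable_RV_eq (k : 'I_M) t (b : bool) : measurable [set w | X k t w = b].
Proof.
have /(_ measurableT [set b] I) := @measurable_funPT _ _ _ _ (X k t).
by rewrite setTI.
Qed.

Lemma network_stateE t (x : F) :
  [set w | network_state t w = x] = [set w | forall k, X k t w = x k].
Proof.
apply/seteqP; split => [w /= <- k|w /= H]; first by rewrite ffunE.
by apply/ffunP => k; rewrite ffunE.
Qed.

Lemma measurable_network_state t (x : F) : measurable [set w | network_state t w = x].
Proof.
rewrite network_stateE.
have -> : [set w | forall k, X k t w = x k] =
          \bigcap_(k in [set: 'I_M]) [set w | X k t w = x k].
  by apply/seteqP; split => w /= H k; [move=> _|]; exact: H.
by apply: fin_bigcap_measurable => // k _; exact: measurable_RV_eq.
Qed.

Definition network_mean phi t : R := fin_mean P (network_state t) phi.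

(** With the joint state at two times, the increment of a mean is the mean of one function of the
    pair, to which pathwise bounds apply. *)
Definition transition t u (w : Omega) : F * F := (network_state t w, network_state u w).

Lemma measurable_transition t u z : measurable [set w | transition t u w = z].
Proof.
have -> : [set w | transition t u w = z] =
    [set w | network_state t w = z.1] `&` [set w | network_state u w = z.2].
  by apply/seteqP; split => w /=; [move=> <-|case: z => ? ? /= [<- <-]].
by apply: measurableI; exact: measurable_network_state.
Qed.

Lemma network_meanB phi t u :
  network_mean phi u - network_mean phi t =
  fin_mean P (transition t u) (fun z => phi z.2 - phi z.1).
Proof.
rewrite fin_meanB /network_mean.
by rewrite -(fin_mean_map P snd)//; [rewrite -(fin_mean_map P fst)//|];
  exact: measurable_transition.
Qed.

Lemma prob_adopted (j : 'I_M) t :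
  fine (P [set w | X j t w = true]) = network_mean (fun x => (x j)%:R) t.
Proof.
rewrite /network_mean fin_mean_indic; last exact: measurable_network_state.
by congr (fine (P _)); apply/seteqP; split => w /=; rewrite ffunE.
Qed.

Lemma adoption_levelE t :
  adoption_level X t = M%:R^-1 * \sum_(j < M) network_mean (fun x => (x j)%:R) t.
Proof.
rewrite /adoption_level; congr (_ * _); apply: eq_bigr => j _.
rewrite -prob_adopted; congr fine.
rewrite unlock.
transitivity (\int[P]_(w in setT) (\1_[set w | X j t w = true] w)%:E)%E.
  apply: eq_integral => w _; rewrite indicE.
  case: (boolP (X j t w)) => H; first by rewrite mem_set.
  by rewrite memNset//=; apply/negP.
rewrite integral_indic ?setIT//.
exact: measurable_RV_eq.
Qed.

End Network.

(** * The forward equation of the network *)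

Definition adopt (M : nat) (x : {ffun 'I_M -> bool}) (j : 'I_M) : {ffun 'I_M -> bool} :=
  [ffun k => (k == j) || x k].

(** The infinitesimal generator of the jump process in which one nonadopter at a time adopts. *)
Definition generator (R : realType) (M : nat) (p q : R -> R) (s : promotion R) (t : R)
    (phi : {ffun 'I_M -> bool} -> R) (x : {ffun 'I_M -> bool}) : R :=
  \sum_(j | ~~ x j) adoption_rate p q s t x j * (phi (adopt x j) - phi x).

(** The number of ordered pairs of distinct nodes that both adopt between [x] and [y]; it measures
    simultaneous adoptions. *)
Definition new_pairs (R : realType) (M : nat) (x y : {ffun 'I_M -> bool}) : R :=
  \sum_j \sum_k [&& j != k, ~~ x j & ~~ x k]%:R * (y j && y k)%:R.

Section OneStep.
Context (R : realType) (M : nat) (phi : {ffun 'I_M -> bool} -> R).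
Implicit Types x y : {ffun 'I_M -> bool}.

Let N : R := \sum_x `|phi x|.

Let phi_le x : `|phi x| <= N.
Proof. by rewrite /N (bigD1 x)//= lerDl sumr_ge0. Qed.

Let phiB_le x y : `|phi x - phi y| <= 2 * N.
Proof.
rewrite (le_trans (ler_normB _ _))//.
by have := phi_le x; have := phi_le y; lra.
Qed.

(** If the state changes at all, monotonicity provides at least one new adopter, and twice the sum
    of the absolute values bounds any difference of [phi]. *)
Lemma one_step_le x y : (forall k, x k -> y k) ->
  `|phi y - phi x| <= 2 * N * \sum_j ((y j)%:R - (x j)%:R).
Proof.
move=> xy.
have ge0 j : 0 <= (y j)%:R - (x j)%:R :> R.
  by rewrite subr_ge0 ler_nat; case: (x j) (xy j) => [->|].
have [->|yx] := eqVneq y x.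
  rewrite subrr normr0 big1 ?mulr0// => j _; exact: subrr.
have [j ynx] : exists j, y j != x j.
  apply/existsP; apply: contraNT yx => /existsPn H.
  by apply/eqP/ffunP => j; have /negPn/eqP := H j.
have yj : (y j)%:R - (x j)%:R = 1 :> R.
  move: (xy j) ynx; case: (y j); case: (x j) => //= H _; first exact: subr0.
  by have := H isT.
rewrite (le_trans (phiB_le _ _))// ler_peMr//; first by rewrite mulr_ge0// sumr_ge0.
by rewrite (bigD1 j)//= yj lerDl sumr_ge0.
Qed.

(** With no new adopter, or exactly one, the expansion is exact. With two or more, [new_pairs] is at
    least 1 and crude bounds suffice: [2 * N] for the increment and [M * (2 * N)] for the sum, hence
    the factor [2 * (M + 1) * N]. *)
Lemma one_step_expansion x y : (forall k, x k -> y k) ->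
  `|phi y - phi x - \sum_(j | ~~ x j) (phi (adopt x j) - phi x) * (y j)%:R|
    <= 2 * (M%:R + 1) * N * new_pairs R x y.
Proof.
move=> xy.
have N0 : 0 <= N by exact: sumr_ge0.
have term_ge0 j k : 0 <= [&& j != k, ~~ x j & ~~ x k]%:R * (y j && y k)%:R :> R.
  by rewrite mulr_ge0.
have np_ge0 : 0 <= new_pairs R x y by apply: sumr_ge0 => j _; apply: sumr_ge0.
have rhs_ge0 : 0 <= 2 * (M%:R + 1) * N * new_pairs R x y.
  by rewrite !mulr_ge0// addr_ge0.
case: (pickP (fun j => y j && ~~ x j)) => [j /andP[yj xj]|none]; last first.
  have yx : y = x.
    by apply/ffunP => k; have := none k; have := xy k; case: (x k) (y k) => [] [] // /(_ isT).
  rewrite {}yx in rhs_ge0 *; rewrite big1 ?subrr ?subr0 ?normr0// => k xk.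
  by rewrite (negbTE xk) mulr0.
case: (pickP (fun k => [&& j != k, y k & ~~ x k])) => [k /and3P[jk yk xk]|only].
  have np1 : 1 <= new_pairs R x y.
    rewrite /new_pairs (bigD1 j)//= (bigD1 k)//= jk xj xk yj yk mulr1 -addrA lerDl.
    by rewrite addr_ge0// ?sumr_ge0// => i _; rewrite sumr_ge0.
  rewrite (@le_trans _ _ (2 * (M%:R + 1) * N))//; last first.
    by rewrite ler_peMr// !mulr_ge0// addr_ge0.
  rewrite (le_trans (ler_normB _ _))//.
  have := phiB_le y x.
  suff : `|\sum_(i | ~~ x i) (phi (adopt x i) - phi x) * (y i)%:R| <= M%:R * (2 * N) by lra.
  rewrite (le_trans (ler_norm_sum _ _ _))//.
  rewrite (@le_trans _ _ (\sum_(i : 'I_M | ~~ x i) 2 * N))//.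
    apply: ler_sum => i _; rewrite normrM (le_trans _ (phiB_le (adopt x i) x))//.
    by rewrite ler_piMr// ger0_norm// lern1 leq_b1.
  rewrite sumr_const [leRHS]mulr_natl.
  apply: ler_wpMn2l; first by rewrite mulr_ge0.
  by rewrite -[leqRHS]card_ord max_card.
have yj' : y = adopt x j.
  apply/ffunP => k; rewrite ffunE; have [->|kj] := eqVneq k j; first by rewrite yj.
  have := only k; rewrite eq_sym kj /=; have := xy k.
  by case: (x k) (y k) => [] [] // /(_ isT).
rewrite {}yj' in rhs_ge0 *; rewrite (bigD1 j)//= big1 => [|k /andP[xk kj]].
  by rewrite ffunE eqxx /= mulr1 addr0 subrr normr0.
by rewrite ffunE (negbTE kj) (negbTE xk) mulr0.
Qed.

End OneStep.

Section ForwardEquation.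
Context (R : realType) (M : nat) (T : R) (p q : R -> R) (d : measure_display)
  (Omega : measurableType d) (P : probability Omega R) (s : promotion R)
  (X : 'I_M -> R -> {RV P >-> bool}).
Hypothesis hX : bass_process T p q s X.
Implicit Types (phi : {ffun 'I_M -> bool} -> R) (t u : R).

Lemma network_state_mono t u w : 0 <= t -> t <= u -> u <= T ->
  forall k, network_state X t w k -> network_state X u w k.
Proof.
move=> t0 tu uT k; rewrite !ffunE; case: hX => _ + _ _ _.
by move=> /(_ k t u w t0 tu uT).
Qed.

Lemma network_mean_dist_le phi t u : 0 <= t -> t <= u -> u <= T ->
  `|network_mean X phi u - network_mean X phi t| <=
    2 * (\sum_x `|phi x|) *
    \sum_j (fine (P [set w | X j u w = true]) - fine (P [set w | X j t w = true])).
Proof.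
move=> t0 tu uT; rewrite network_meanB.
under [X in _ <= _ * X]eq_bigr => j _ do rewrite !prob_adopted network_meanB.
rewrite -fin_mean_sum -fin_meanZ; apply: fin_mean_norm => w.
by apply: one_step_le => k; exact: network_state_mono.
Qed.

(** Pathwise monotonicity bounds the variation of every mean by that of the individual adoption
    probabilities, whose continuity is the last clause of [bass_process]. *)
Lemma continuous_network_mean phi : {within `[0, T], continuous (network_mean X phi)}.
Proof.
pose F (j : 'I_M) t : R := fine (P [set w | X j t w = true]).
have cF j : {within `[0, T], continuous (F j)} by case: hX => _ _ _ _; exact.
apply/subspace_continuousP => t /= t0T.
pose D u : R := 2 * (\sum_x `|phi x|) * \sum_j `|F j u - F j t|.
have D0 : D u @[u --> within `[0, T] (nbhs t)] -->
    2 * (\sum_x `|phi x|) * \sum_(j < M) (0 : R).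
  apply: cvgM; first exact: cvg_cst.
  apply: cvg_sumr => j _.
  by apply: cvg_dist0; have /subspace_continuousP := cF j; exact.
rewrite [X in _ * X]big1// mulr0 in D0.
apply/cvgrPdist_le => e e0; move/cvgrPdist_le: D0 => /(_ _ e0) D0.
apply: filterS2 (withinT `[0, T] (nbhs_filter t)) D0 => u /= u0T.
rewrite sub0r normrN; apply: le_trans; rewrite (le_trans _ (ler_norm _))//.
move: t0T u0T; rewrite /D !in_itv/= => /andP[t0 tT] /andP[u0 uT].
have [tu|ut] := leP t u.
  rewrite distrC (le_trans (network_mean_dist_le phi t0 tu uT))//.
  rewrite ler_wpM2l ?mulr_ge0 ?sumr_ge0//.
  by apply: ler_sum => j _; exact: ler_norm.
rewrite (le_trans (network_mean_dist_le phi u0 (ltW ut) tT))//.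
rewrite ler_wpM2l ?mulr_ge0 ?sumr_ge0//.
by apply: ler_sum => j _; rewrite distrC; exact: ler_norm.
Qed.

Lemma prob_state_adopted t u (x : {ffun 'I_M -> bool}) (Q : pred {ffun 'I_M -> bool}) :
  fin_mean P (transition X t u) (fun z => ((z.1 == x) && Q z.2)%:R) =
  fine (P ([set w | Q (network_state X u w)] `&` [set w | forall k, X k t w = x k])).
Proof.
rewrite (fin_mean_indic P (fun z => (z.1 == x) && Q z.2)); last first.
  exact: measurable_transition.
congr (fine (P _)); rewrite -network_stateE; apply/seteqP; split => w /=.
  by move=> /andP[/eqP].
by move=> [Qw /eqP ->].
Qed.

(** Passing from conditional to joint probabilities also covers the states of probability zero,
    about which the one-step law is silent: both sides then vanish. *)
Lemma cond_prob_cvg t (A : R -> set Omega) (x : {ffun 'I_M -> bool}) (l : R) :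
  (forall u, measurable (A u)) ->
  let B := [set w | forall k, X k t w = x k] in
  ((0 < P B)%E -> cond_prob P (A (t + h)) B / h @[h --> 0^'+] --> l) ->
  fine (P (A (t + h) `&` B)) / h @[h --> 0^'+] --> fine (P B) * l.
Proof.
move=> mA B HB.
have mB : measurable B by rewrite /B -network_stateE; exact: measurable_network_state.
have [PB|PB] := ltP 0%E (P B).
  have PB0 : fine (P B) != 0.
    by rewrite gt_eqF// fine_gt0// PB/= ltey_eq fin_num_measure.
  apply: (@cvg_trans _ (fine (P B) * (cond_prob P (A (t + h)) B / h) @[h --> 0^'+])).
    apply: near_eq_cvg; near=> h.
    by rewrite /= /cond_prob mulrA mulrCA mulfV// mulr1.
  by apply: cvgM; [exact: cvg_cst|exact: HB].
have PB0 : P B = 0%E by apply/eqP; rewrite eq_le PB measure_ge0.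
rewrite PB0 /= mul0r.
under [X in X @ _ --> _]funext => h.
  rewrite (subset_measure0 _ _ (@subIsetr _ (A (t + h)) B))//; last exact: measurableI.
  rewrite mul0r.
  over.
exact: cvg_cst.
Unshelve. all: by end_near. Qed.

(** The increment of [phi] is split into single adoptions, whose rate is the generator by the
    individual one-step laws, and an error dominated by the mean of [new_pairs], which is [o(h)] by
    the clause on simultaneous adoptions. *)
Lemma forward_equation phi t : t \in `[0, T[ -> promotion_continuous_in T s t ->
  right_derivative (network_mean X phi) t (network_mean X (generator p q s t phi) t).
Proof.
move=> t0T ct; have [t0 tT] : 0 <= t /\ t < T by move: t0T; rewrite in_itv/= => /andP.
case: hX => _ _ h1 h2 _.
pose Z h := transition X t (t + h).
pose lin (z : {ffun 'I_M -> bool} * {ffun 'I_M -> bool}) : R :=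
  \sum_(j | ~~ z.1 j) (phi (adopt z.1 j) - phi z.1) * (z.2 j)%:R.
pose np (z : {ffun 'I_M -> bool} * {ffun 'I_M -> bool}) := new_pairs R z.1 z.2.
have adoptedE j u : [set w | network_state X u w j] = [set w | X j u w = true].
  by apply/seteqP; split => w /=; rewrite ffunE.
have linE h : fin_mean P (Z h) lin / h =
    \sum_(x : {ffun 'I_M -> bool}) \sum_(j | ~~ x j)
    (phi (adopt x j) - phi x) *
    (fine (P ([set w | X j (t + h) w = true] `&` [set w | forall k, X k t w = x k])) / h).
  have -> : lin = fun z => \sum_(x : {ffun 'I_M -> bool}) \sum_(j | ~~ x j)
      (phi (adopt x j) - phi x) * ((z.1 == x) && z.2 j)%:R.
    apply/funext => z; rewrite (bigD1 z.1)//= [X in _ = _ + X]big1 ?addr0.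
      by apply: eq_bigr => j _; rewrite eqxx.
    move=> x; rewrite eq_sym => /negbTE zx.
    by rewrite big1// => j _; rewrite zx mulr0.
  rewrite fin_mean_sum big_distrl; apply: eq_bigr => x _ /=.
  rewrite fin_mean_sum big_distrl; apply: eq_bigr => j _ /=.
  by rewrite fin_meanZ (prob_state_adopted _ _ _ (fun y => y j)) adoptedE mulrA.
have npE h : fin_mean P (Z h) np / h =
    \sum_(x : {ffun 'I_M -> bool}) \sum_j \sum_k
    [&& j != k, ~~ x j & ~~ x k]%:R *
    (fine (P (([set w | X j (t + h) w = true] `&` [set w | X k (t + h) w = true])
       `&` [set w | forall k, X k t w = x k])) / h).
  have -> : np = fun z => \sum_(x : {ffun 'I_M -> bool}) \sum_j \sum_k
      [&& j != k, ~~ x j & ~~ x k]%:R * ((z.1 == x) && (z.2 j && z.2 k))%:R.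
    apply/funext => z; rewrite (bigD1 z.1)//= [X in _ = _ + X]big1 ?addr0.
      by apply: eq_bigr => j _; apply: eq_bigr => k _; rewrite eqxx.
    move=> x; rewrite eq_sym => /negbTE zx.
    by rewrite big1// => j _; rewrite big1// => k _; rewrite zx mulr0.
  rewrite fin_mean_sum big_distrl; apply: eq_bigr => x _ /=.
  rewrite fin_mean_sum big_distrl; apply: eq_bigr => j _ /=.
  rewrite fin_mean_sum big_distrl; apply: eq_bigr => k _ /=.
  rewrite fin_meanZ (prob_state_adopted _ _ _ (fun y => y j && y k)) mulrA -!adoptedE.
  congr (_ * fine (P (_ `&` _)) / h); apply/seteqP; split => w /=.
    by move=> /andP.
  by move=> [-> ->].
have linC : fin_mean P (Z h) lin / h @[h --> 0^'+] -->
    network_mean X (generator p q s t phi) t.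
  under [X in X @ _ --> _]funext => h do rewrite linE.
  rewrite /network_mean /fin_mean.
  apply: cvg_sumr => x _; rewrite /generator big_distrl; apply: cvg_sumr => j xj /=.
  rewrite mulrAC mulrC; apply: cvgM; first exact: cvg_cst.
  rewrite mulrC network_stateE.
  apply: (@cond_prob_cvg t (fun u => [set w | X j u w = true])).
    by move=> u; exact: measurable_RV_eq.
  by move=> B PB; apply: h1 => //; exact: negbTE.
have npC : fin_mean P (Z h) np / h @[h --> 0^'+] --> (0 : R).
  under [X in X @ _ --> _]funext => h do rewrite npE.
  suff : \sum_(x : {ffun 'I_M -> bool}) \sum_j \sum_k
    [&& j != k, ~~ x j & ~~ x k]%:R *
    (fine (P (([set w | X j (t + h) w = true] `&` [set w | X k (t + h) w = true])
       `&` [set w | forall k, X k t w = x k])) / h) @[h --> 0^'+] -->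
      \sum_(x : {ffun 'I_M -> bool}) \sum_(j < M) \sum_(k < M) (0 : R).
    by rewrite [X in _ --> X]big1// => x _; rewrite big1// => j _; rewrite big1.
  apply: cvg_sumr => x _; apply: cvg_sumr => j _; apply: cvg_sumr => k _.
  have [/and3P[jk xj xk]|] := boolP [&& j != k, ~~ x j & ~~ x k]; last first.
    move=> _; under [X in X @ _ --> _]funext => h do rewrite mul0r.
    exact: cvg_cst.
  rewrite -[X in _ --> X](mulr0 1); apply: cvgM; first exact: cvg_cst.
  rewrite -[X in _ --> X](mulr0 (fine (P [set w | forall k, X k t w = x k]))).
  apply: (@cond_prob_cvg t
     (fun u => [set w | X j u w = true] `&` [set w | X k u w = true])).
    by move=> u; apply: measurableI; exact: measurable_RV_eq.
  by move=> B PB; apply: h2 => //; exact: negbTE.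
pose C : R := 2 * (M%:R + 1) * \sum_x `|phi x|.
have C0 : 0 <= C by rewrite !mulr_ge0 ?addr_ge0 ?sumr_ge0.
have bound : \forall h \near 0^'+,
    `|(network_mean X phi (t + h) - network_mean X phi t) / h - fin_mean P (Z h) lin / h|
    <= C * (fin_mean P (Z h) np / h).
  near=> h.
  have h0 : 0 < h by near: h; exact: nbhs_right_gt.
  have hT : t + h <= T by rewrite -lerBrDl; near: h; apply: nbhs_right_le; rewrite subr_gt0.
  rewrite -mulrBl mulrA normrM [`|h^-1|]gtr0_norm ?invr_gt0// ler_pM2r ?invr_gt0//.
  rewrite network_meanB -fin_meanB -fin_meanZ; apply: fin_mean_norm => w.
  apply: one_step_expansion => k; apply: network_state_mono => //.
  by rewrite lerDl ltW.
have diffC : (network_mean X phi (t + h) - network_mean X phi t) / h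
    - fin_mean P (Z h) lin / h @[h --> 0^'+] --> (0 : R).
  apply/cvgrPdist_le => e e0.
  have CC : C * (fin_mean P (Z h) np / h) @[h --> 0^'+] --> (0 : R).
    by rewrite -[X in _ --> X](mulr0 C); apply: cvgM => //; exact: cvg_cst.
  move/cvgrPdist_le: CC => /(_ _ e0) CC; near=> h.
  rewrite sub0r normrN.
  have : `|(network_mean X phi (t + h) - network_mean X phi t) / h - fin_mean P (Z h) lin / h|
    <= C * (fin_mean P (Z h) np / h) by near: h.
  move=> /le_trans; apply.
  have : `|0 - C * (fin_mean P (Z h) np / h)| <= e by near: h.
  by rewrite sub0r normrN; apply: le_trans; exact: ler_norm.
apply: (@cvg_trans _ (((network_mean X phi (t + h) - network_mean X phi t) / h
    - fin_mean P (Z h) lin / h) + fin_mean P (Z h) lin / h @[h --> 0^'+])).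
  by apply: near_eq_cvg; near=> h; rewrite subrK.
by have := cvgD diffC linC; rewrite add0r; exact.
Unshelve. all: by end_near. Qed.

End ForwardEquation.

(** * The equations for the nonadoption probabilities *)

Definition nonadopters (M : nat) (x : {ffun 'I_M -> bool}) : nat := #|[pred j | ~~ x j]|.

(* Fraction of the n-subsets of nodes without adopters: averaging over all
   subsets of a given size replaces the symmetry argument defining [S^n]. *)
Definition nonadopter_fraction (R : realType) (M n : nat) (x : {ffun 'I_M -> bool}) : R :=
  'C(nonadopters x, n)%:R / 'C(M, n)%:R.

Section Binomial.
Context (R : realType) (M : nat).
Implicit Types x : {ffun 'I_M -> bool}.

Lemma nonadopters_le x : (nonadopters x <= M)%N.
Proof. by rewrite -[leqRHS]card_ord max_card. Qed.

Lemma nonadopters_adopt x j : ~~ x j -> nonadopters (adopt x j) = (nonadopters x).-1.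
Proof.
move=> xj; rewrite /nonadopters (cardD1 j [pred j | ~~ x j]) inE xj /=.
apply: eq_card => k; rewrite !inE ffunE negb_or; by [].
Qed.

Lemma sum_adopters x j : ~~ x j ->
  \sum_(k < M | k != j) (x k)%:R = M%:R - (nonadopters x)%:R :> R.
Proof.
move=> xj.
have -> : \sum_(k < M | k != j) (x k)%:R = \sum_(k < M) (x k)%:R :> R.
  by rewrite [RHS](bigD1 j)//= (negbTE xj) add0r.
have -> : (nonadopters x)%:R = \sum_(k < M) (~~ x k)%:R :> R.
  rewrite /nonadopters -sum1_card big_mkcond natr_sum.
  by apply: eq_bigr => k _ /=; rewrite inE; case: (x k).
have -> : M%:R = \sum_(k < M) 1 :> R by rewrite sumr_const card_ord.
by rewrite -sumrB; apply: eq_bigr => k _; case: (x k); rewrite (subrr, subr0).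
Qed.

(** Pascal's rule turns the difference into [- 'C(m.-1, n)], and absorbing the factor [m] gives the
    right-hand side. It is the effect of [m] possible adoptions on the number of nonadopting
    subsets. *)
Lemma binomial_pascal_r (m n : nat) :
  m%:R * ('C(m.-1, n.+1)%:R - 'C(m, n.+1)%:R) = - (n.+1%:R * 'C(m, n.+1)%:R) :> R.
Proof.
case: m => [|m]; first by rewrite mul0r bin0n mulr0 oppr0.
rewrite -[in RHS]natrM -mul_bin_diag natrM /= binS natrD; ring.
Qed.

Lemma binomial_succ_r (m n : nat) :
  n.+1%:R * 'C(m, n.+1)%:R = (m%:R - n%:R) * 'C(m, n)%:R :> R.
Proof.
have [nm|mn] := leqP n m; first by rewrite -natrM mul_bin_left natrM natrB.
by rewrite !bin_small// ?mulr0// ltnW.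
Qed.

(** This closes the hierarchy. With [m] nonadopters, each adopts at rate [a + b (M - m) / (M - 1)],
    so the fraction [f_n] decreases at that rate times [n f_n]. Writing [M - m = (M - n) - (m - n)]
    and using [(M - n) f_(n+1) = (m - n) f_n] replaces the dependence on [m] by the next
    fraction. *)
Lemma generator_nonadopter_fraction (p q : R -> R) (s : promotion R) (t : R) (n : nat) x :
  (1 <= n <= M)%N ->
  generator p q s t (nonadopter_fraction R n) x =
  nonadopter_rhs M p q (fun k => nonadopter_fraction R k x) n (spend_p s t) (spend_q s t).
Proof.
case: n => [//|n] /andP[_ nM].
set m := nonadopters x; set a := p (spend_p s t); set b := q (spend_q s t).
have C0 : 'C(M, n.+1)%:R != 0 :> R by rewrite pnatr_eq0 -lt0n bin_gt0.
have -> : generator p q s t (nonadopter_fraction R n.+1) x =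
    - (a + b / (M%:R - 1) * (M%:R - m%:R)) * (n.+1%:R * 'C(m, n.+1)%:R) / 'C(M, n.+1)%:R.
  rewrite /generator (eq_bigr (fun=> (a + b / (M%:R - 1) * (M%:R - m%:R)) *
    ('C(m.-1, n.+1)%:R - 'C(m, n.+1)%:R) / 'C(M, n.+1)%:R)); last first.
    move=> j xj; rewrite /adoption_rate sum_adopters// /nonadopter_fraction.
    by rewrite nonadopters_adopt// -mulrBl mulrA.
  rewrite sumr_const -[LHS]mulr_natl mulrA mulrCA mulrA.
  rewrite -[#|_|]/m.
  by rewrite mulNr -mulrN -binomial_pascal_r; ring.
rewrite /nonadopter_rhs /nonadopter_fraction -/m -/a -/b.
have key : (M%:R - n.+1%:R) * ('C(m, n.+2)%:R / 'C(M, n.+2)%:R) =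
    (m%:R - n.+1%:R) * 'C(m, n.+1)%:R / 'C(M, n.+1)%:R :> R.
  have := binomial_succ_r m n.+1; have := binomial_succ_r M n.+1.
  (* At the top size the denominator ['C(M, M.+1)] is zero. The left side vanishes through its
     coefficient, the right side because [m = M] or ['C(m, M) = 0]. *)
  have [->|nltM] := eqVneq n.+1 M.
    rewrite subrr !mul0r.
    have [->|mM] := eqVneq m M; first by rewrite subrr !mul0r.
    by rewrite (@bin_small m M) ?mulr0 ?mul0r// ltn_neqAle mM nonadopters_le.
  have C1 : 'C(M, n.+2)%:R != 0 :> R.
    by rewrite pnatr_eq0 -lt0n bin_gt0 ltn_neqAle nltM.
  move=> HM Hm; have n2 : n.+2%:R != 0 :> R by rewrite pnatr_eq0.
  have -> : M%:R - n.+1%:R = n.+2%:R * 'C(M, n.+2)%:R / 'C(M, n.+1)%:R :> R.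
    by rewrite HM mulfK.
  by rewrite -Hm; field; rewrite C0 C1.
set u := 'C(m, n.+2)%:R / 'C(M, n.+2)%:R in key *.
set v := 'C(m, n.+1)%:R in key *.
have -> : n.+1%:R * ((M%:R - n.+1%:R) / (M%:R - 1)) * b * u =
    n.+1%:R * b / (M%:R - 1) * ((M%:R - n.+1%:R) * u) by ring.
rewrite key; ring.
Qed.

End Binomial.

(** * Continuity of the rates and of the state equation in time *)

Lemma continuous_within_interior (R : realType) (T : R) (f : R -> R) (t : R) :
  {within `[0, T], continuous f} -> t \in `]0, T[ -> {for t, continuous f}.
Proof.
move=> /subspace_continuousP cf t0T; apply/(continuous_in_interior _ t0T).
by apply: cf; exact: subset_itv_oo_cc.
Qed.

Lemma cvg_influence_rate (R : realType) (r g : R -> R) (l : R) (F : set_system R)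
    {FF : Filter F} : influence_rate r -> 0 <= l -> (\forall u \near F, 0 <= g u) ->
  g u @[u --> F] --> l -> r (g u) @[u --> F] --> r l.
Proof.
move=> [_ cr _] l0 g0 gl.
have {}cr : r x @[x --> within `[0, +oo[ (nbhs l)] --> r l.
  by move/subspace_continuousP : cr; apply; rewrite /= in_itv/= l0.
apply: cvg_trans cr => B /= cB; have {cB} := gl _ cB; rewrite /= => cB.
change (\forall u \near F, B (r (g u))).
near=> u; have : `[0, +oo[%classic (g u) -> B (r (g u)) by near: u; exact: cB.
by apply; rewrite /= in_itv/= andbT; near: u.
Unshelve. all: by end_near. Qed.

Lemma continuous_influence_rate (R : realType) (T : R) (r g : R -> R) (t : R) :
  influence_rate r -> admissible_spending T g -> t \in `]0, T[ ->
  {for t, continuous g} -> {for t, continuous (fun u => r (g u))}.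
Proof.
move=> hr [_ g0] t0T; apply: cvg_influence_rate => //.
  by apply: g0; exact: subset_itv_oo_cc.
near=> u; apply: g0; apply: subset_itv_oo_cc; near: u; exact: near_in_itvoo.
Unshelve. all: by end_near. Qed.

Definition regular_at (R : realType) (s : promotion R) (t : R) : Prop :=
  {for t, continuous (spend_p s)} /\ {for t, continuous (spend_q s)}.

Lemma admissible_regular (R : realType) (T : R) (s : promotion R) : admissible T s ->
  exists E : seq R, forall t : R, t \in `]0, T[ -> t \notin E -> regular_at s t.
Proof.
move=> [[[[E1 H1] _ _] _] [[[E2 H2] _ _] _]].
exists (E1 ++ E2) => t t0T; rewrite mem_cat negb_or => /andP[t1 t2].
by split; apply/(continuous_in_interior _ t0T);
  [apply: H1|apply: H2] => //; exact: subset_itv_oo_cc.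
Qed.

Lemma continuous_nonadopter_rhs (R : realType) (M : nat) (T : R) (p q : R -> R)
    (s : promotion R) (y : nat -> R -> R) (n : nat) (t : R) :
  influence_rate p -> influence_rate q -> admissible T s -> t \in `]0, T[ ->
  regular_at s t -> {for t, continuous (y n)} -> {for t, continuous (y n.+1)} ->
  {for t, continuous (fun u => nonadopter_rhs M p q (y ^~ u) n (spend_p s u) (spend_q s u))}.
Proof.
move=> hp hq [ap aq] t0T [cp cq] cy cy'.
have Cp := continuous_influence_rate hp ap t0T cp.
have Cq := continuous_influence_rate hq aq t0T cq.
apply: cvgD; apply: cvgM => //; first apply: cvgN; first apply: cvgD.
- by apply: cvgM => //; exact: cvg_cst.
- by apply: cvgM => //; exact: cvg_cst.
- by apply: cvgM => //; exact: cvg_cst.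
Qed.

Section NonadopterEquation.
Context (R : realType) (M : nat) (T : R) (p q : R -> R) (d : measure_display)
  (Omega : measurableType d) (P : probability Omega R) (s : promotion R)
  (X : 'I_M -> R -> {RV P >-> bool}).
Hypotheses (hX : bass_process T p q s X) (M_gt0 : (0 < M)%N).

Definition nonadopter_mean (n : nat) : R -> R := network_mean X (nonadopter_fraction R n).

Lemma nonadopter_mean0 n : (n <= M)%N -> nonadopter_mean n 0 = 1.
Proof.
move=> nM.
have Z0 w : network_state X 0 w = [ffun=> false].
  by apply/ffunP => k; rewrite !ffunE; case: hX => -> .
have f1 w : nonadopter_fraction R n (network_state X 0 w) = 1.
  rewrite Z0 /nonadopter_fraction.
  have -> : nonadopters ([ffun=> false] : {ffun 'I_M -> bool}) = M.
    by apply: etrans (card_ord M); apply: eq_card => k; rewrite !inE ffunE.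
  by rewrite divff// pnatr_eq0 -lt0n bin_gt0.
transitivity (fin_mean P (network_state X 0) (fun=> true%:R)).
  by apply/eqP; rewrite eq_le; apply/andP; split; apply: fin_mean_le => w; rewrite f1.
rewrite (fin_mean_indic P predT); last exact: measurable_network_state.
have -> : [set w | predT (network_state X 0 w)] = setT by apply/seteqP; split.
by rewrite probability_setT.
Qed.

Lemma nonadopter_mean_rhs n t : (1 <= n <= M)%N ->
  network_mean X (generator p q s t (nonadopter_fraction R n)) t =
  nonadopter_rhs M p q (nonadopter_mean ^~ t) n (spend_p s t) (spend_q s t).
Proof.
move=> nM; rewrite /nonadopter_rhs /nonadopter_mean /network_mean -!fin_meanZ -fin_meanD.
by apply: eq_bigr => x _; rewrite generator_nonadopter_fraction.
Qed.

Lemma continuous_nonadopter_mean n : {within `[0, T], continuous (nonadopter_mean n)}.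
Proof. exact: (continuous_network_mean hX). Qed.

Lemma adoption_level_nonadopter t : adoption_level X t = 1 - nonadopter_mean 1 t.
Proof.
have M0 : M%:R != 0 :> R by rewrite pnatr_eq0 -lt0n.
have E (x : {ffun 'I_M -> bool}) : M%:R^-1 * \sum_(j < M) (x j)%:R =
    true%:R - nonadopter_fraction R 1 x.
  rewrite /nonadopter_fraction !bin1.
  have -> : (nonadopters x)%:R = M%:R - \sum_(j < M) (x j)%:R :> R.
    have -> : M%:R = \sum_(k < M) 1 :> R by rewrite sumr_const card_ord.
    rewrite -sumrB /nonadopters -sum1_card big_mkcond natr_sum.
    by apply: eq_bigr => k _ /=; rewrite inE; case: (x k); rewrite (subrr, subr0).
  by rewrite -[true%:R]/(1 : R); field.
rewrite adoption_levelE /nonadopter_mean /network_mean -fin_mean_sum -fin_meanZ.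
transitivity (fin_mean P (network_state X t) (fun x => true%:R - nonadopter_fraction R 1 x)).
  by apply: eq_bigr => x _; rewrite E.
rewrite fin_meanB; congr (_ - _).
rewrite (fin_mean_indic P predT); last exact: measurable_network_state.
have -> : [set w | predT (network_state X t w)] = setT by apply/seteqP; split.
by rewrite probability_setT.
Qed.

(** The forward equation gives right derivatives off a finite set; at a regular time the right-hand
    side is continuous, which upgrades them to a two-sided derivative. *)
Lemma is_derive_nonadopter_mean n t : influence_rate p -> influence_rate q ->
  admissible T s -> (1 <= n <= M)%N -> t \in `]0, T[ -> regular_at s t ->
  is_derive t 1 (nonadopter_mean n)
    (nonadopter_rhs M p q (nonadopter_mean ^~ t) n (spend_p s t) (spend_q s t)).
Proof.
move=> hp hq adm nM t0T reg.
have [E HE] := admissible_regular adm.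
pose r u := nonadopter_rhs M p q (nonadopter_mean ^~ u) n (spend_p s u) (spend_q s u).
apply: (@is_derive_of_right_derivative _ E _ r 0 T).
- exact: continuous_nonadopter_mean.
- move=> u u0T uE; rewrite /r -nonadopter_mean_rhs//.
  have u0T' : u \in `]0, T[ by rewrite in_itv.
  have [cp cq] := HE u u0T' uE.
  apply: (forward_equation hX).
    by move: u0T; rewrite in_itv/= => /andP[/ltW -> ->].
  by split; apply/continuous_in_interior.
- by move: t0T; rewrite in_itv.
- by apply: (continuous_nonadopter_rhs hp hq adm t0T reg);
    apply: continuous_within_interior (t0T); exact: continuous_nonadopter_mean.
Qed.

End NonadopterEquation.
Arguments continuous_nonadopter_mean {R M T p q d Omega P s X} hX n.

(** Equation [n] involves only components [n] and [n.+1], so uniqueness descends from [n = M]. Once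
    the components [n.+1] agree, the squared difference [w] has derivative [- 2 a w], with [a >= 0]
    since the rates are nonnegative. It cannot grow from its initial value 0; this sign plays the
    part of a Gronwall estimate. *)
Lemma nonadopter_unique (R : realType) (M : nat) (p q sp sq : R -> R) (c : R) (E : seq R)
    (y z : nat -> R -> R) : (1 < M)%N ->
  (forall t, t \in `]0, c[ -> 0 <= p (sp t) /\ 0 <= q (sq t)) ->
  (forall n, (1 <= n <= M)%N -> y n 0 = z n 0) ->
  (forall n, (1 <= n <= M)%N -> {within `[0, c], continuous (y n)}) ->
  (forall n, (1 <= n <= M)%N -> {within `[0, c], continuous (z n)}) ->
  (forall n t, (1 <= n <= M)%N -> t \in `]0, c[ -> t \notin E ->
     is_derive t 1 (y n) (nonadopter_rhs M p q (y ^~ t) n (sp t) (sq t))) ->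
  (forall n t, (1 <= n <= M)%N -> t \in `]0, c[ -> t \notin E ->
     is_derive t 1 (z n) (nonadopter_rhs M p q (z ^~ t) n (sp t) (sq t))) ->
  forall n t, (1 <= n <= M)%N -> t \in `[0, c] -> y n t = z n t.
Proof.
move=> M1 pq0 yz0 cy cz dy dz.
have M10 : 0 < M%:R - 1 :> R by rewrite subr_gt0 ltr1n.
(* The factor [M%:R - n%:R] in the premise makes it automatic at [n = M], so the start of the
   induction needs nothing about component [M.+1]. *)
have step n : (1 <= n <= M)%N ->
    (forall u, u \in `]0, c[ -> (M%:R - n%:R) * (y n.+1 u - z n.+1 u) = 0) ->
    forall t, t \in `[0, c] -> y n t = z n t.
  move=> nM next t; rewrite in_itv/= => /andP[t0 tc].
  pose w u := (y n u - z n u) * (y n u - z n u).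
  pose a u := n%:R * p (sp u) + n%:R * ((M%:R - n%:R) / (M%:R - 1)) * q (sq u).
  have cw : {within `[0, t], continuous w}.
    have sub : `[0, t] `<=` `[0, c].
      by move=> u /=; rewrite !in_itv/= => /andP[-> /le_trans ->].
    have cyz : {within `[0, t], continuous (fun u => y n u - z n u)}.
      by apply: continuous_subspaceW sub _ => u; apply: cvgB; [exact: cy|exact: cz].
    by move=> u; apply: cvgM; exact: cyz.
  have dw u : 0 < u < t -> u \notin E ->
      right_derivative w u (- (2 * a u) * w u).
    move=> /andP[u0 ut] uE; have u0c : u \in `]0, c[ by rewrite in_itv/= u0 (lt_le_trans ut).
    have dyu := dy n u nM u0c uE; have dzu := dz n u nM u0c uE.
    apply: is_derive_right_derivative; rewrite /w.
    have dD := is_deriveB dyu dzu; apply: (is_derive_eq (is_deriveM dD dD)).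
    have N : (M%:R - n%:R) * (y n.+1 u - z n.+1 u) = 0 by exact: next.
    transitivity (- (2 * a u) * w u + 2 * (y n u - z n u) * n%:R * q (sq u) / (M%:R - 1)
        * ((M%:R - n%:R) * (y n.+1 u - z n.+1 u))); last by rewrite N mulr0 addr0.
    rewrite /w /a /nonadopter_rhs /GRing.scale /=.
    by rewrite -[(y n - z n) u]/(y n u - z n u); ring.
  have w0 : w t - w 0 <= 0 * (t - 0).
    apply: (right_derivative_le t0 cw dw) => u /andP[u0 ut] uE.
    have u0c : u \in `]0, c[ by rewrite in_itv/= u0 (lt_le_trans ut).
    have [p0 q0] := pq0 u u0c.
    have Mn : 0 <= M%:R - n%:R :> R by rewrite subr_ge0 ler_nat; case/andP: nM.
    have a0 : 0 <= a u.
      apply: addr_ge0; first exact: mulr_ge0.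
      by apply: mulr_ge0 => //; apply: mulr_ge0 => //; apply: divr_ge0 => //; exact: ltW.
    rewrite mulNr oppr_le0; apply: mulr_ge0; first exact: mulr_ge0.
    by rewrite /w -expr2 sqr_ge0.
  move: w0; rewrite mul0r subr_le0 {2}/w yz0// subrr mul0r /w -expr2 => w0.
  apply/eqP; rewrite -subr_eq0 -sqrf_eq0; apply/eqP.
  by apply/eqP; rewrite eq_le w0 sqr_ge0.
suff H k : forall n, (M - n)%N = k -> (1 <= n <= M)%N ->
    forall t, t \in `[0, c] -> y n t = z n t.
  by move=> n t nM; exact: (H (M - n)%N).
elim: k => [|k IH] n nk nM; apply: step => // u u0c.
  have -> : n = M by lia.
  by rewrite subrr mul0r.
by rewrite IH ?subrr ?mulr0//; [lia|lia|exact: subset_itv_oo_cc].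
Qed.

(** * The profit *)

Definition bounded_on (R : realType) (A : set R) (f : R -> R) : Prop :=
  exists C : R, forall t, A t -> `|f t| <= C.

Section BoundedOn.
Context (R : realType) (A : set R).
Implicit Types f g : R -> R.

Lemma bounded_on_cst (c : R) : bounded_on A (fun=> c).
Proof. by exists `|c|. Qed.

Lemma bounded_onN f : bounded_on A f -> bounded_on A (fun t => - f t).
Proof. by move=> [C fC]; exists C => t At; rewrite normrN fC. Qed.

Lemma bounded_onD f g : bounded_on A f -> bounded_on A g -> bounded_on A (fun t => f t + g t).
Proof.
move=> [C fC] [D gD]; exists (C + D) => t At.
by rewrite (le_trans (ler_normD _ _))// lerD ?fC ?gD.
Qed.

Lemma bounded_onM f g : bounded_on A f -> bounded_on A g -> bounded_on A (fun t => f t * g t).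
Proof.
move=> [C fC] [D gD]; exists (C * D) => t At.
by rewrite normrM ler_pM ?fC ?gD.
Qed.

End BoundedOn.

Lemma continuous_bounded_on (R : realType) (a b : R) (f : R -> R) :
  {within `[a, b], continuous f} -> bounded_on `[a, b] f.
Proof.
move=> cf; have [ab|ba] := leP a b; last first.
  by exists 0 => t /=; rewrite in_itv/= => /andP[/le_trans h /h]; rewrite leNgt ba.
have cn : {within `[a, b], continuous (fun t => `|f t|)}.
  by move=> t; apply: cvg_norm; exact: cf.
by have [c _ H] := EVT_max ab cn; exists `|f c| => t tab; exact: H.
Qed.

Lemma influence_rate_bounded (R : realType) (T : R) (r g : R -> R) :
  influence_rate r -> admissible_spending T g -> bounded_on `[0, T] (fun t => r (g t)).
Proof.
move=> [_ cr _] [pc g0]; have [C gC] := piecewise_continuous_bounded pc.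
have [D rD] : bounded_on `[0, C] r.
  apply: continuous_bounded_on; apply: continuous_subspaceW cr => x /=.
  by rewrite !in_itv/= => /andP[->].
exists D => t t0T; apply: rD; rewrite /= in_itv/= g0//=.
by rewrite (le_trans (ler_norm _))// gC.
Qed.

Section ProfitPrimitive.
Context (R : realType) (M : nat) (T theta gamma : R) (p q : R -> R) (d : measure_display)
  (Omega : measurableType d) (P : probability Omega R) (s : promotion R)
  (X : 'I_M -> R -> {RV P >-> bool}).
Hypotheses (M_gt1 : (1 < M)%N) (T_gt0 : 0 < T) (hp : influence_rate p)
  (hq : influence_rate q) (adm : admissible T s) (hX : bass_process T p q s X).

Let Y := nonadopter_mean X.

Definition running_profit t : R :=
  (- gamma * nonadopter_rhs M p q (Y ^~ t) 1 (spend_p s t) (spend_q s t)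
    - (spend_p s t + spend_q s t)) * expR (- (theta * t)).

Lemma continuous_discount : continuous (fun t : R => expR (- (theta * t))).
Proof.
move=> t; apply: (@continuous_comp _ _ _ (fun t : R => - (theta * t)) expR).
  by apply: cvgN; apply: cvgM; [exact: cvg_cst|exact: cvg_id].
exact: continuous_expR.
Qed.

Lemma continuous_running_profit t : t \in `]0, T[ -> regular_at s t ->
  {for t, continuous running_profit}.
Proof.
move=> t0T reg; apply: cvgM; last exact: continuous_discount.
apply: cvgB; last by apply: cvgD; [exact: reg.1|exact: reg.2].
apply: cvgM; first exact: cvg_cst.
by apply: (continuous_nonadopter_rhs hp hq adm t0T reg);
  apply: continuous_within_interior (t0T); exact: (continuous_nonadopter_mean hX).
Qed.

Lemma running_profit_bounded : bounded_on `[0, T] running_profit.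
Proof.
have [[pcp _] [pcq _]] := adm.
have bp := influence_rate_bounded hp adm.1; have bq := influence_rate_bounded hq adm.2.
have bY n : bounded_on `[0, T] (Y n).
  by apply: continuous_bounded_on; exact: (continuous_nonadopter_mean hX).
have bsp : bounded_on `[0, T] (spend_p s) by exact: piecewise_continuous_bounded.
have bsq : bounded_on `[0, T] (spend_q s) by exact: piecewise_continuous_bounded.
apply: bounded_onM; last first.
  by apply: continuous_bounded_on; apply: continuous_subspaceT; exact: continuous_discount.
apply: bounded_onD; last by apply: bounded_onN; exact: bounded_onD.
apply: bounded_onM; first exact: bounded_on_cst.
apply: bounded_onD; apply: bounded_onM => //.
  apply: bounded_onN; apply: bounded_onD; apply: bounded_onM => //; exact: bounded_on_cst.
by apply: bounded_onM => //; exact: bounded_on_cst.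
Qed.

Let f t : R := expR (- (theta * t)) *
  (gamma * ((adoption_level X)^`())%classic t - (spend_p s t + spend_q s t)).

Let fE t : t \in `]0, T[ -> regular_at s t -> f t = running_profit t.
Proof.
move=> t0T reg; rewrite /f /running_profit mulrC; congr ((_ - _) * _).
rewrite mulNr -mulrN; congr (_ * _); rewrite derive1E.
have -> : adoption_level X = (cst 1 : R -> R) - Y 1.
  by apply/funext => u; rewrite (adoption_level_nonadopter X) ?(ltnW M_gt1).
have nM : (1 <= 1 <= M)%N by lia.
have dY := is_derive_nonadopter_mean hX hp hq adm nM t0T reg.
by have := is_deriveB (is_derive_cst (1 : R) t 1) dY => -[_ ->]; rewrite sub0r.
Qed.

(** Replaces the integral by a continuous function with known derivative off a finite set, the form
    in which two profits are compared later. *)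
Lemma profit_primitive : exists (I : R -> R) (E : seq R),
  [/\ {within `[0, T], continuous I}, I 0 = 0, I T = profit T theta gamma s X &
      forall t : R, t \in `]0, T[ -> t \notin E -> is_derive t 1 I (running_profit t)].
Proof.
have [E HE] := admissible_regular adm.
(* The integrand contains [derive1] of the adoption level, which is controlled only at regular
   times. Continuity is transferred from [running_profit], with which it agrees on a neighbourhood
   of [t] avoiding [E]. *)
have cf t : t \in `]0, T[ -> t \notin E -> {for t, continuous f}.
  move=> t0T tE; rewrite /prop_for /continuous_at (fE t0T (HE _ t0T tE)).
  apply: cvg_trans (continuous_running_profit t0T (HE _ t0T tE)).
  apply: near_eq_cvg; have nE := near_notin tE; have nT := near_in_itvoo t0T.
  near=> u; have u0T : u \in `]0, T[ by near: u.
  by apply/esym/fE => //; apply: HE => //; near: u.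
have [C HC] := running_profit_bounded.
have intf : (@lebesgue_measure R).-integrable `[0, T] (EFin \o f).
  apply: (@continuous_bounded_integrable _ _ C E) => // t t0T tE.
  by rewrite fE//; [apply: HC; exact: subset_itv_oo_cc|exact: HE].
exists (fun x => \int[lebesgue_measure]_(t in `[0, x]) f t), E; split.
- exact: (parameterized_integral_continuous (ltW T_gt0) intf).
- by rewrite set_itv1 Rintegral_set1.
- by [].
move=> t t0T tE; have /andP[t0 tT] : 0 < t < T by move: t0T; rewrite in_itv.
have [dI I'E] := continuous_FTC1_closed tT intf t0 (cf t t0T tE).
by apply: DeriveDef => //; rewrite -derive1E I'E fE//; exact: HE.
Unshelve. all: by end_near. Qed.

End ProfitPrimitive.

(** * The Hamiltonian *)

Lemma is_derive_sumr (R : realType) (I : eqType) (r : seq I) (h : I -> R -> R)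
    (dh : I -> R) (t : R) :
  (forall i, i \in r -> is_derive t 1 (h i) (dh i)) ->
  is_derive t 1 (fun u => \sum_(i <- r) h i u) (\sum_(i <- r) dh i).
Proof.
elim: r => [|i r IH] H.
  rewrite big_nil; under [X in is_derive _ _ X]funext => u do rewrite big_nil.
  exact: is_derive_cst.
rewrite big_cons; under [X in is_derive _ _ X]funext => u do rewrite big_cons.
apply: is_deriveD; first by apply: H; rewrite mem_head.
by apply: IH => j jr; apply: H; rewrite inE jr orbT.
Qed.

Section Hamiltonian.
Context (R : realType) (M : nat) (theta gamma : R) (p q : R -> R).
Hypothesis M_gt1 : (1 < M)%N.
Implicit Types y psi : nat -> R -> R.

Lemma nonadopter_rhs_congr (y z : nat -> R) n (a b : R) : (1 <= n <= M)%N ->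
  (forall k, (1 <= k <= M)%N -> y k = z k) ->
  nonadopter_rhs M p q y n a b = nonadopter_rhs M p q z n a b.
Proof.
move=> nM yz; rewrite /nonadopter_rhs yz//; congr (_ + _).
have [->|nneM] := eqVneq n M; first by rewrite subrr mul0r mulr0 !mul0r.
by rewrite (yz n.+1)//; lia.
Qed.

Lemma nonadopter_rhsB (y z : nat -> R) n (a b : R) :
  nonadopter_rhs M p q y n a b - nonadopter_rhs M p q z n a b =
  nonadopter_rhs M p q (fun k => y k - z k) n a b.
Proof. rewrite /nonadopter_rhs; ring. Qed.

Lemma hamiltonian_congr y z psi t (a b : R) :
  (forall k, (1 <= k <= M)%N -> y k t = z k t) ->
  hamiltonian M theta gamma p q y psi t a b = hamiltonian M theta gamma p q z psi t a b.
Proof.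
move=> yz; rewrite /hamiltonian (@nonadopter_rhs_congr (y ^~ t) (z ^~ t))//; last by lia.
by congr (_ + _); apply: eq_big_nat => n nM; rewrite (@nonadopter_rhs_congr (y ^~ t) (z ^~ t)).
Qed.

(** [coef_p] and [coef_q] are the factors of [p] and [q] in the right-hand side for [[S^n]]. *)
Definition coef_p (y : nat -> R) (n : nat) : R := - (n%:R * y n).

Definition coef_q (y : nat -> R) (n : nat) : R :=
  n%:R * ((M%:R - n%:R) / (M%:R - 1)) * (y n.+1 - y n).

(** For [k] equal to [coef_p] or [coef_q], the factor of [p] or [q] in the Hamiltonian. It involves
    the spending only through the state and costate, so it stays continuous across jumps of the
    promotion. *)
Definition hamiltonian_coef (k : (nat -> R) -> nat -> R) y psi t : R :=
  - gamma * k (y ^~ t) 1%N * expR (- (theta * t)) + \sum_(1 <= n < M.+1) psi n t * k (y ^~ t) n.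

Lemma hamiltonianE y psi t (a b : R) :
  hamiltonian M theta gamma p q y psi t a b =
  p a * hamiltonian_coef coef_p y psi t + q b * hamiltonian_coef coef_q y psi t
    - (a + b) * expR (- (theta * t)).
Proof.
have rhsE n : nonadopter_rhs M p q (y ^~ t) n a b =
    p a * coef_p (y ^~ t) n + q b * coef_q (y ^~ t) n.
  by rewrite /nonadopter_rhs /coef_p /coef_q; ring.
rewrite /hamiltonian /hamiltonian_coef rhsE.
under eq_bigr => n _ do rewrite rhsE mulrDr [psi n t * (p a * _)]mulrCA
  [psi n t * (q b * _)]mulrCA.
rewrite big_split /= -!big_distrr /=; ring.
Qed.

End Hamiltonian.

(* The costate equation is the adjoint of the linear equation for [S^n]. *)
Lemma costate_adjoint (R : realType) (M : nat) (theta gamma : R) (p q : R -> R)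
    (psi D : nat -> R) (t a b : R) : (1 < M)%N ->
  \sum_(1 <= n < M.+1) (costate_rhs M theta gamma p q psi t n a b * D n
    + psi n * nonadopter_rhs M p q D n a b) =
  gamma * expR (- (theta * t)) * nonadopter_rhs M p q D 1 a b.
Proof.
move=> M1; set c := gamma * expR (- (theta * t)).
(* [u n] is the coupling term of costate equation [n]. The coupling to [D n.+1] in the state
   equation matches [u n.+1], so the sum telescopes. Both ends vanish: the factor [n - 1] is zero at
   [n = 1], and [M - n + 1] is zero at [n = M + 1]. *)
pose u n : R := ((1 < n)%N%:R * psi n.-1 - (n == 2%N)%:R * c)
    * ((n%:R - 1) * ((M%:R - n%:R + 1) / (M%:R - 1))) * q b * D n.
have termE n : (1 <= n < M.+1)%N ->
    costate_rhs M theta gamma p q psi t n a b * D n + psi n * nonadopter_rhs M p q D n a b =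
    (n == 1%N)%:R * (c * nonadopter_rhs M p q D n a b) + (u n.+1 - u n).
  case: n => [//|[|n]] _; rewrite /u /costate_rhs /nonadopter_rhs -/c /=; ring.
rewrite (eq_big_nat _ _ termE) big_split /= telescope_sumr//.
rewrite big_ltn; last by lia.
rewrite -[(1 == 1)%N%:R]/(1 : R) mul1r big_nat big1 ?addr0; last first.
  by move=> n /andP[n1 _]; rewrite gtn_eqF// mul0r.
have -> : u M.+1 = 0 by rewrite /u -natr1 opprD addrA subrr sub0r addNr mul0r !mulr0 !mul0r.
by rewrite /u -[1%:R]/(1 : R) subrr !(mul0r, mulr0) subrr addr0.
Qed.

(** A general filter serves both ordinary neighbourhoods of interior times and neighbourhoods inside
    [[0, T]], endpoints included. *)
Lemma cvg_hamiltonian_coef (R : realType) (M : nat) (theta gamma : R)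
    (k : (nat -> R) -> nat -> R) (y psi : nat -> R -> R) (t : R)
    (F : set_system R) {FF : Filter F} :
  u @[u --> F] --> t ->
  (forall n, k (y ^~ u) n @[u --> F] --> k (y ^~ t) n) ->
  (forall n, (1 <= n <= M)%N -> psi n u @[u --> F] --> psi n t) ->
  hamiltonian_coef M theta gamma k y psi u @[u --> F] -->
    hamiltonian_coef M theta gamma k y psi t.
Proof.
move=> Ft cy cpsi; apply: cvgD.
  apply: cvgM; first by apply: cvgM => //; exact: cvg_cst.
  by move=> B /continuous_discount /Ft.
under [X in X @ _ --> _]funext => u do rewrite big_nat_cond.
rewrite big_nat_cond; apply: cvg_sumr => n; rewrite andbT => nM.
by apply: cvgM => //; exact: cpsi.
Qed.

(** * Needle perturbations and pointwise maxima *)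

Definition needle_promotion (R : realType) (s : promotion R) (a b v w : R) : promotion R :=
  Promotion (needle (spend_p s) a b v) (needle (spend_q s) a b w).

Lemma admissible_needle (R : realType) (T : R) (s : promotion R) (a b v w : R) :
  0 <= v -> 0 <= w -> admissible T s -> admissible T (needle_promotion s a b v w).
Proof.
move=> v0 w0 [[pcp p0] [pcq q0]]; split; split => /=.
- exact: piecewise_continuous_needle.
- by move=> t t0T; rewrite /needle; case: ifP => // _; exact: p0.
- exact: piecewise_continuous_needle.
- by move=> t t0T; rewrite /needle; case: ifP => // _; exact: q0.
Qed.

Lemma exists_itv_notin (R : realType) (E : seq R) (a b : R) : a < b ->
  exists2 u : R, u \in `]a, b[ & u \notin E.
Proof.
elim: E a b => [|e E IH] a b ab.
  by exists ((a + b) / 2); rewrite // in_itv/=; apply/andP; split; lra.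
have [/andP[ae eb]|naeb] := boolP (a < e < b).
  have [u] := IH a e ae; rewrite in_itv/= => /andP[au ue] uE.
  by exists u; rewrite ?in_itv/= ?au ?(lt_trans ue)// inE negb_or lt_eqF.
have [u uab uE] := IH a b ab; exists u => //; rewrite inE negb_or uE andbT.
by apply: contraNneq naeb => <-; move: uab; rewrite in_itv.
Qed.

(** A strict violation at [t] would persist nearby by continuity of [g], [A] and [e], hence also at
    some interior time off the finite set [E]. Jumps of the other spending component are absorbed in
    [E]. *)
Lemma influence_max_closure (R : realType) (T : R) (r g A e : R -> R) (E : seq R) (v t : R) :
  0 < T -> influence_rate r -> (forall u : R, u \in `[0, T] -> 0 <= g u) -> t \in `[0, T] ->
  A u @[u --> within `[0, T] (nbhs t)] --> A t ->
  e u @[u --> within `[0, T] (nbhs t)] --> e t ->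
  (forall u : R, u \in `]0, T[ -> u \notin E -> r v * A u - v * e u <= r (g u) * A u - g u * e u) ->
  continuous_in T g t -> r v * A t - v * e t <= r (g t) * A t - g t * e t.
Proof.
move=> T0 hr g0 t0T cA ce max_u cg; rewrite leNgt; apply/negP => gap.
pose f u := r v * A u - v * e u - (r (g u) * A u - g u * e u).
have cf : f u @[u --> within `[0, T] (nbhs t)] --> f t.
  have crg : r (g u) @[u --> within `[0, T] (nbhs t)] --> r (g t).
    apply: cvg_influence_rate => //; first exact: g0.
    near=> u; apply: g0; near: u; exact: withinT.
  by apply: cvgB; apply: cvgB; apply: cvgM => //; exact: cvg_cst.
have ft : 0 < f t by rewrite subr_gt0.
move/cvgrPdist_lt : cf => /(_ _ ft) /nbhs_ballP[c /= c0 Hc].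
have [u] : exists2 u : R, u \in `]Num.max 0 (t - c), Num.min T (t + c)[ & u \notin E.
  apply: exists_itv_notin; move: t0T; rewrite in_itv/= => /andP[t0 tT].
  by rewrite gt_max !lt_min; apply/andP; split; apply/andP; split; lra.
rewrite in_itv/= gt_max lt_min => /andP[/andP[u0 tu] /andP[uT ut]] uE.
have u0T : u \in `]0, T[ by rewrite in_itv/= u0.
have /Hc : ball t c u by rewrite /ball/= ltr_norml; apply/andP; split; lra.
move=> /(_ (subset_itv_oo_cc u0T)); have := max_u u u0T uE.
by rewrite -subr_le0 -/(f u) ltr_norml => fu /andP[_]; lra.
Unshelve. all: by end_near. Qed.

(** Fermat's rule on []0, x + 1[]: positivity of [x] makes the maximum interior and keeps to the
    range where [r] is differentiable. *)
Lemma influence_max_is_derive (R : realType) (r : R -> R) (A e x : R) :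
  influence_rate r -> 0 < x ->
  (forall v, 0 <= v -> r v * A - v * e <= r x * A - x * e) ->
  is_derive x 1 (fun u => r u * A - u * e) 0.
Proof.
move=> [_ _ dr] x0 xmax.
apply: (@derive1_at_max _ _ 0 (x + 1)).
- by rewrite addr_ge0// ltW.
- move=> u; rewrite in_itv/= => /andP[u0 _].
  apply: derivableB; apply: derivableM => //; exact: dr.
- by rewrite in_itv/= x0 ltrDl ltr01.
- by move=> u; rewrite in_itv/= => /andP[/ltW u0 _]; exact: xmax.
Qed.

(** * The maximum principle for the optimal promotion *)

Section Maximum.
Context (R : realType) (M : nat) (T theta gamma : R) (p q : R -> R)
  (d : measure_display) (Omega : measurableType d) (P : probability Omega R)
  (X : promotion R -> 'I_M -> R -> {RV P >-> bool}).
Hypotheses (M_gt1 : (1 < M)%N) (T_gt0 : 0 < T)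
  (hp : influence_rate p) (hq : influence_rate q)
  (hX : forall s, admissible T s -> bass_process T p q s (X s)).

Let Y s := nonadopter_mean (X s).

Let rates_ge0 s (t : R) : admissible T s -> t \in `[0, T] ->
  0 <= p (spend_p s t) /\ 0 <= q (spend_q s t).
Proof. by move=> [[_ p0] [_ q0]] t0T; case: hp hq => + _ _ [+ _ _]; split; auto. Qed.

Let subT (c t : R) : c <= T -> t \in `]0, c[ -> t \in `]0, T[.
Proof. by move=> cT; rewrite !in_itv/= => /andP[-> /lt_le_trans ->]. Qed.

Let within_sub (c : R) (f : R -> R) : c <= T -> {within `[0, T], continuous f} ->
  {within `[0, c], continuous f}.
Proof.
move=> cT; apply: continuous_subspaceW => t /=; rewrite !in_itv/= => /andP[-> tc].
exact: le_trans tc cT.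
Qed.

(** Causality of the averages: the state up to time [c] depends only on the spending before [c]. It
    is derived from uniqueness, the two processes being unrelated pathwise. *)
Lemma nonadopter_mean_agree s1 s2 (c : R) : admissible T s1 -> admissible T s2 -> c <= T ->
  (forall t, t \in `]0, c[ -> spend_p s1 t = spend_p s2 t /\ spend_q s1 t = spend_q s2 t) ->
  forall n t, (1 <= n <= M)%N -> t \in `[0, c] -> Y s1 n t = Y s2 n t.
Proof.
move=> a1 a2 cT agree; have [E1 H1] := admissible_regular a1.
have [E2 H2] := admissible_regular a2.
apply: (@nonadopter_unique _ _ p q (spend_p s1) (spend_q s1) c (E1 ++ E2)) => //.
- move=> t t0c; apply: rates_ge0 => //; apply: subset_itv_oo_cc; exact: subT t0c.
- by move=> n /andP[_ nM]; rewrite /Y (nonadopter_mean0 (hX a1))// (nonadopter_mean0 (hX a2)).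
- by move=> n _; apply: within_sub cT _; exact: continuous_nonadopter_mean (hX a1) n.
- by move=> n _; apply: within_sub cT _; exact: continuous_nonadopter_mean (hX a2) n.
- move=> n t nM t0c; rewrite mem_cat negb_or => /andP[tE1 tE2].
  by apply: (is_derive_nonadopter_mean (hX a1)) => //; [exact: subT t0c|
    apply: H1 => //; exact: subT t0c].
- move=> n t nM t0c; rewrite mem_cat negb_or => /andP[tE1 tE2].
  have [-> ->] := agree t t0c.
  by apply: (is_derive_nonadopter_mean (hX a2)) => //; [exact: subT t0c|
    apply: H2 => //; exact: subT t0c].
Qed.

Lemma nonadopter_solution_unique s S_ : admissible T s -> nonadopter_solution M T p q s S_ ->
  forall n t, (1 <= n <= M)%N -> t \in `[0, T] -> S_ n t = Y s n t.
Proof.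
move=> adm hS; have [E HE] := admissible_regular adm.
apply: (@nonadopter_unique _ _ p q (spend_p s) (spend_q s) T E) => //.
- by move=> t t0T; apply: rates_ge0 => //; exact: subset_itv_oo_cc.
- by move=> n nM; have [_ -> _] := hS n nM; case/andP: nM => _ nM;
    rewrite /Y (nonadopter_mean0 (hX adm)).
- by move=> n nM; have [] := hS n nM.
- by move=> n _; exact: continuous_nonadopter_mean (hX adm) n.
- move=> n t nM t0T tE; have [_ _] := hS n nM; apply => //.
  by have [cp cq] := HE t t0T tE; split; apply/continuous_in_interior.
- by move=> n t nM t0T tE; apply: (is_derive_nonadopter_mean (hX adm)) => //; exact: HE.
Qed.

Variables (sopt : promotion R) (Psi_ : nat -> R -> R).
Hypotheses (hopt : optimal_promotion T theta gamma X sopt)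
  (hPsi : costate_solution M T theta gamma p q sopt Psi_).

Let adm : admissible T sopt. Proof. by case: hopt. Qed.

Local Notation H := (hamiltonian M theta gamma p q).

(* The profit difference is exactly the integral of the Hamiltonian increment along
   the perturbed state. *)
Lemma profit_variation s : admissible T s -> exists (G : R -> R) (E : seq R),
  [/\ {within `[0, T], continuous G}, G 0 = 0, G T <= 0 &
      forall t, t \in `]0, T[ -> t \notin E -> is_derive t 1 G
        (H (Y s) Psi_ t (spend_p s t) (spend_q s t) -
         H (Y s) Psi_ t (spend_p sopt t) (spend_q sopt t))].
Proof.
move=> a1.
have [I1 [E1 [cI1 I10 I1T dI1]]] := profit_primitive theta gamma M_gt1 T_gt0 hp hq a1 (hX a1).
have [I0 [E0 [cI0 I00 I0T dI0]]] := profit_primitive theta gamma M_gt1 T_gt0 hp hq adm (hX adm).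
have [E1' HE1] := admissible_regular a1; have [E0' HE0] := admissible_regular adm.
pose D n t := Y s n t - Y sopt n t.
(* The sum vanishes at both ends, since the two states start equal and the costate is zero at [T].
   The end value is therefore exactly the profit difference, nonpositive by optimality. *)
exists (fun t => I1 t - I0 t + \sum_(1 <= n < M.+1) Psi_ n t * D n t).
exists (E1 ++ E0 ++ E1' ++ E0'); split.
- apply/subspace_continuousP => x /= x0T.
  have W f : {within `[0, T], continuous f} ->
      f u @[u --> within `[0, T] (nbhs x)] --> (f x : R).
    by move=> /subspace_continuousP; exact.
  apply: cvgD; first by apply: cvgB; exact: W.
  under [X in X @ _ --> _]funext => u do rewrite big_nat_cond.
  rewrite big_nat_cond; apply: cvg_sumr => n; rewrite andbT => nM.
  apply: cvgM; first by apply: W; have [] := hPsi nM.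
  by apply: cvgB; apply: W;
    [exact: continuous_nonadopter_mean (hX a1) n|exact: continuous_nonadopter_mean (hX adm) n].
- rewrite I10 I00 subrr add0r big_nat big1// => n nM.
  by rewrite /D /Y (nonadopter_mean0 (hX a1)) ?(nonadopter_mean0 (hX adm)) ?subrr ?mulr0//; lia.
- rewrite big_nat big1 ?addr0; last first.
    by move=> n nM; have [_ -> _] := hPsi nM; rewrite mul0r.
  by rewrite I1T I0T subr_le0; case: hopt => _; exact.
move=> t t0T; rewrite !mem_cat !negb_or => /and4P[t1 t0 t1' t0'].
have reg0 := HE0 t t0T t0'; have reg1 := HE1 t t0T t1'.
pose F1 n := nonadopter_rhs M p q (Y s ^~ t) n (spend_p s t) (spend_q s t).
pose F0 n := nonadopter_rhs M p q (Y sopt ^~ t) n (spend_p sopt t) (spend_q sopt t).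
(* The intermediate term has the perturbed state but the optimal rates. [F1 - F] builds the
   Hamiltonian increment, while [F - F0] is the linear equation applied to [D], which the adjoint
   identity cancels. *)
pose F n := nonadopter_rhs M p q (Y s ^~ t) n (spend_p sopt t) (spend_q sopt t).
pose C n := costate_rhs M theta gamma p q (Psi_ ^~ t) t n (spend_p sopt t) (spend_q sopt t).
have dS : is_derive t 1 (fun u => \sum_(1 <= n < M.+1) Psi_ n u * D n u)
    (\sum_(1 <= n < M.+1) (Psi_ n t * (F1 n - F0 n) + D n t * C n)).
  apply: is_derive_sumr => n; rewrite mem_index_iota => nM.
  apply: is_deriveM.
    have [_ _] := hPsi nM; apply => //.
    by have [cp cq] := reg0; split; apply/continuous_in_interior.
  apply: is_deriveB; first exact: (is_derive_nonadopter_mean (hX a1)).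
  exact: (is_derive_nonadopter_mean (hX adm)).
apply: (is_derive_eq (is_deriveD (is_deriveB (dI1 t t0T t1) (dI0 t t0T t0)) dS)).
have adj := costate_adjoint theta gamma p q (Psi_ ^~ t) (D ^~ t) t (spend_p sopt t)
  (spend_q sopt t) M_gt1.
rewrite -!nonadopter_rhsB -/(F 1%N) -/(F0 1%N) in adj.
rewrite (eq_bigr (fun n => (Psi_ n t * F1 n - Psi_ n t * F n) + (C n * D n t +
   Psi_ n t * nonadopter_rhs M p q (D ^~ t) n (spend_p sopt t) (spend_q sopt t)))); last first.
  by move=> n _; rewrite -nonadopter_rhsB -/(F n) -/(F0 n); ring.
rewrite big_split /= adj sumrB /running_profit /hamiltonian -/(F1 1%N) -/(F0 1%N) -/(F 1%N).
by rewrite -[X in _ = _ - (_ + X)]/(\sum_(1 <= n < M.+1) Psi_ n t * F n); ring.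
Qed.

Lemma hamiltonian_le (t v w : R) : t \in `]0, T[ -> regular_at sopt t -> 0 <= v -> 0 <= w ->
  H (Y sopt) Psi_ t v w <= H (Y sopt) Psi_ t (spend_p sopt t) (spend_q sopt t).
Proof.
move=> t0T [ctp ctq] v0 w0; rewrite leNgt; apply/negP => gap.
have /andP[t0 tT] : 0 < t < T by move: t0T; rewrite in_itv.
have ttt : t \in `[0, t] by rewrite in_itv/= ltW/=.
(* By uniqueness a needle on [t, b[ and one on [t, T[ produce the same state up to time b,
   so b can be chosen by continuity of the state perturbed on [t, T[. *)
pose s0 := needle_promotion sopt t T v w.
have a0 : admissible T s0 by exact: admissible_needle.
have s0Y n : (1 <= n <= M)%N -> Y s0 n t = Y sopt n t.
  move=> nM; apply: (@nonadopter_mean_agree s0 sopt t) => //; first exact: ltW.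
  move=> u; rewrite in_itv/= => /andP[_ ut].
  by rewrite /needle (leNgt t u) ut.
(* The Hamiltonian gap along the state of [s0], which is still the optimal state at [t]; [gap]
   therefore makes [k t] positive. *)
pose k u := H (Y s0) Psi_ u v w - H (Y s0) Psi_ u (spend_p sopt u) (spend_q sopt u).
have kt : 0 < k t by rewrite /k !(hamiltonian_congr theta gamma p q M_gt1 _ _ _ s0Y)// subr_gt0.
have ck : {for t, continuous k}.
  have cY n : {for t, continuous (Y s0 n)}.
    apply: continuous_within_interior (t0T).
    exact: continuous_nonadopter_mean (hX a0) n.
  have cPsi n : (1 <= n <= M)%N -> {for t, continuous (Psi_ n)}.
    by move=> nM; apply: continuous_within_interior (t0T); have [] := hPsi nM.
  have cA : {for t, continuous (hamiltonian_coef M theta gamma (@coef_p R) (Y s0) Psi_)}.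
    apply: cvg_hamiltonian_coef => // n; apply: cvgN.
    by apply: cvgM; [exact: cvg_cst|exact: cY].
  have cB : {for t, continuous (hamiltonian_coef M theta gamma (@coef_q R M) (Y s0) Psi_)}.
    apply: cvg_hamiltonian_coef => // n.
    by apply: cvgM; [exact: cvg_cst|apply: cvgB; exact: cY].
  have cp := continuous_influence_rate hp adm.1 t0T ctp.
  have cq := continuous_influence_rate hq adm.2 t0T ctq.
  have ce : {for t, continuous (fun u : R => expR (- (theta * u)))}.
    exact: continuous_discount.
  have cH (a c : R -> R) : {for t, continuous a} -> {for t, continuous c} ->
      {for t, continuous (fun u => p (a u))} -> {for t, continuous (fun u => q (c u))} ->
      {for t, continuous (fun u => H (Y s0) Psi_ u (a u) (c u))}.
    move=> ca cc cpa cqc.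
    rewrite (funext (fun u => hamiltonianE M theta gamma p q (Y s0) Psi_ u (a u) (c u))).
    apply: cvgB; first by apply: cvgD; apply: cvgM.
    by apply: cvgM => //; exact: cvgD.
  by apply: cvgB; [apply: (cH (fun=> v) (fun=> w)); exact: cvg_cst|exact: cH].
have [e e0 ke] : exists2 e, 0 < e & forall u, t <= u <= t + e -> k t / 2 <= k u.
  have kt2 : 0 < k t / 2 by rewrite divr_gt0.
  move/cvgrPdist_lt : ck => /(_ _ kt2)/nbhs_ballP[e /= e0 He].
  exists (e / 2) => [|u /andP[tu ue]]; first by rewrite divr_gt0.
  have /He : ball t e u by rewrite /ball/= ltr_norml; apply/andP; split; lra.
  by rewrite /= ltr_norml => /andP[]; lra.
(* The needle stays where the gap is at least [k t / 2] and ends strictly before [T]. *)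
pose b := Num.min (t + e) ((t + T) / 2).
have tb : t < b by rewrite lt_min; apply/andP; split; lra.
have bT : b < T by rewrite gt_min; apply/orP; right; lra.
have be : b <= t + e by rewrite ge_min lexx.
pose s1 := needle_promotion sopt t b v w.
have a1 : admissible T s1 by exact: admissible_needle.
have s1Y n u : (1 <= n <= M)%N -> u \in `[0, b] -> Y s1 n u = Y s0 n u.
  apply: nonadopter_mean_agree => //; first exact: ltW.
  move=> {}u; rewrite in_itv/= => /andP[_ ub].
  by rewrite /needle ub (lt_trans ub bT) !andbT.
have [G [E [cG G0 GT dG]]] := profit_variation a1.
have G_ge a c K : 0 <= a -> a <= c -> c <= T ->
    (forall u, a < u < c -> u \notin E -> K <=
       H (Y s1) Psi_ u (spend_p s1 u) (spend_q s1 u) -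
       H (Y s1) Psi_ u (spend_p sopt u) (spend_q sopt u)) -> K * (c - a) <= G c - G a.
  move=> a_ge0 ac cT; apply: is_derive_ge => //.
    apply: continuous_subspaceW cG => u /=; rewrite !in_itv/= => /andP[au uc].
    by rewrite (le_trans a_ge0 au) (le_trans uc cT).
  move=> u /andP[au uc] uE; apply: dG => //.
  by rewrite in_itv/= (le_lt_trans a_ge0 au) (lt_le_trans uc cT).
have G1 : 0 * (t - 0) <= G t - G 0.
  apply: G_ge => //; [exact: ltW|exact: ltW|] => u /andP[u0 ut] _.
  by rewrite /= /needle (leNgt t u) ut subrr.
have G2 : k t / 2 * (b - t) <= G b - G t.
  apply: G_ge => //; [exact: ltW|exact: ltW|exact: ltW|] => u /andP[tu ub] _.
  have u0b : u \in `[0, b] by rewrite in_itv/= (ltW ub) (ltW (lt_trans t0 tu)).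
  have yz n : (1 <= n <= M)%N -> Y s1 n u = Y s0 n u by move=> nM; exact: s1Y.
  rewrite !(hamiltonian_congr theta gamma p q M_gt1 _ _ _ yz)// /= /needle (ltW tu) ub /=.
  by apply: ke; rewrite (ltW tu)/= (le_trans (ltW ub)).
(* After the needle the two states may differ, but both Hamiltonians are taken at the perturbed
   state with equal spending, so the increment is zero. *)
have G3 : 0 * (T - b) <= G T - G b.
  apply: G_ge => //; [exact: ltW (lt_trans t0 tb)|exact: ltW|] => u /andP[bu uT] _.
  by rewrite /= /needle (ltNge u b) (ltW bu) andbF subrr.
have : 0 < k t / 2 * (b - t) by apply: mulr_gt0; [exact: divr_gt0|rewrite subr_gt0].
by lra.
Qed.

(** Leaving the other component at its optimal value cancels its contribution from [hamiltonian_le].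
    What remains no longer sees the jumps of that component, so the closure lemma reaches every time
    in [[0, T]]. *)
Lemma hamiltonian_coef_max (t : R) : t \in `[0, T] ->
  let A k := hamiltonian_coef M theta gamma k (Y sopt) Psi_ t in
  (continuous_in T (spend_p sopt) t -> forall v, 0 <= v ->
     p v * A (@coef_p R) - v * expR (- (theta * t)) <=
     p (spend_p sopt t) * A (@coef_p R) - spend_p sopt t * expR (- (theta * t))) /\
  (continuous_in T (spend_q sopt) t -> forall v, 0 <= v ->
     q v * A (@coef_q R M) - v * expR (- (theta * t)) <=
     q (spend_q sopt t) * A (@coef_q R M) - spend_q sopt t * expR (- (theta * t))).
Proof.
move=> t0T A; have [E HE] := admissible_regular adm.
have cY n : Y sopt n u @[u --> within `[0, T] (nbhs t)] --> Y sopt n t.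
  by have /subspace_continuousP := continuous_nonadopter_mean (hX adm) n; exact.
have cPsi n : (1 <= n <= M)%N -> Psi_ n u @[u --> within `[0, T] (nbhs t)] --> Psi_ n t.
  by move=> nM; have [/subspace_continuousP + _ _] := hPsi nM; exact.
have cid : u @[u --> within `[0, T] (nbhs t)] --> t by apply: cvg_within_filter; exact: cvg_id.
have [[_ p0] [_ q0]] := adm.
split => ct v v0.
  apply: (@influence_max_closure _ T p _
    (hamiltonian_coef M theta gamma (@coef_p R) (Y sopt) Psi_)
    (fun u => expR (- (theta * u))) E v t) ct => //.
  - apply: cvg_hamiltonian_coef => // n; apply: cvgN.
    by apply: cvgM; [exact: cvg_cst|exact: cY].
  - by move=> B /continuous_discount /cid.
  move=> u u0T uE.
  have [_ sq0] := rates_ge0 adm (subset_itv_oo_cc u0T).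
  have := hamiltonian_le u0T (HE u u0T uE) v0 (q0 u (subset_itv_oo_cc u0T)).
  by rewrite !hamiltonianE; lra.
apply: (@influence_max_closure _ T q _
  (hamiltonian_coef M theta gamma (@coef_q R M) (Y sopt) Psi_)
    (fun u => expR (- (theta * u))) E v t) ct => //.
- apply: cvg_hamiltonian_coef => // n.
  by apply: cvgM; [exact: cvg_cst|apply: cvgB; exact: cY].
- by move=> B /continuous_discount /cid.
move=> u u0T uE.
have := hamiltonian_le u0T (HE u u0T uE) (p0 u (subset_itv_oo_cc u0T)) v0.
by rewrite !hamiltonianE; lra.
Qed.

End Maximum.

Lemma is_derive0_addr (R : realType) (f g : R -> R) (c x : R) :
  (forall u, g u = f u + c) -> is_derive x 1 f 0 -> is_derive x 1 g 0.
Proof.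
move=> /funext -> df; apply: is_derive_eq (is_deriveD df (is_derive_cst c x 1)) _.
exact: addr0.
Qed.

Theorem theorem2 (R : realType) (M : nat) (T theta gamma : R) (p q : R -> R)
    (hM : (2 <= M)%N) (hT : 0 < T)
    (hp : influence_rate p) (hq : influence_rate q)
    (d : measure_display) (Omega : measurableType d) (P : probability Omega R)
    (X : promotion R -> 'I_M -> R -> {RV P >-> bool})
    (hX : forall s, admissible T s -> bass_process T p q s (X s))
    (sopt : promotion R)
    (hopt : optimal_promotion T theta gamma X sopt)
    (S_ Psi_ : nat -> R -> R)
    (hS : nonadopter_solution M T p q sopt S_)
    (hPsi : costate_solution M T theta gamma p q sopt Psi_) :
  forall t : R, t \in `[0, T] ->
    (continuous_in T (spend_p sopt) t -> 0 < spend_p sopt t ->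
       is_derive (spend_p sopt t) 1
         (fun x => hamiltonian M theta gamma p q S_ Psi_ t x (spend_q sopt t)) 0)
    /\
    (continuous_in T (spend_q sopt) t -> 0 < spend_q sopt t ->
       is_derive (spend_q sopt t) 1
         (fun y => hamiltonian M theta gamma p q S_ Psi_ t (spend_p sopt t) y) 0).
Proof.
have [adm _] := hopt.
move=> t t0T.
have SY n : (1 <= n <= M)%N -> S_ n t = nonadopter_mean (X sopt) n t.
  by move=> nM; exact: (nonadopter_solution_unique hM hp hq hX adm hS).
have [Hp Hq] := hamiltonian_coef_max hM hT hp hq hX hopt hPsi t0T.
split => ct s0; [pose x := spend_q sopt t|pose x := spend_p sopt t].
  (* [c] collects the part of the Hamiltonian independent of the differentiated variable. *)
  pose c := q x * hamiltonian_coef M theta gamma (@coef_q R M) (nonadopter_mean (X sopt)) Psi_ t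
    - x * expR (- (theta * t)).
  apply: (is_derive0_addr (c := c)) (influence_max_is_derive hp s0 (Hp ct)) => u.
  by rewrite (hamiltonian_congr theta gamma p q hM _ _ _ SY) hamiltonianE /c /x; ring.
pose c := p x * hamiltonian_coef M theta gamma (@coef_p R) (nonadopter_mean (X sopt)) Psi_ t
  - x * expR (- (theta * t)).
apply: (is_derive0_addr (c := c)) (influence_max_is_derive hq s0 (Hq ct)) => u.
by rewrite (hamiltonian_congr theta gamma p q hM _ _ _ SY) hamiltonianE /c /x; ring.
Qed.
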